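(* Consider the fully dynamic algorithm described below, combined with the doubling scheme for unknown stream length, run on an arbitrary stream of $n$ insertion and deletion operations chosen by an oblivious adversary, and assume $\Delta<\infty$. After every operation $i$ the maintained solution $S^i\subseteq V_i$ is independent and satisfies $\operatorname{OPT}_i\le 4f(S^i)$, and the expected amortized running time is $O(k^2\log k\log^2\Delta\log^2 n)$.
   Context: Setting: $f:2^V\to\mathbb{R}_{\ge0}$ is monotone, submodular and normalized (value oracle), $f(X\mid Y)=f(X\cup Y)-f(Y)$; $\mathcal{M}$ is a matroid on $V$ of rank $k$ (independence oracle). $V_i$ is the set of elements inserted and not deleted in the first $i$ operations; $\operatorname{OPT}_i=\max\{f(T):T\subseteq V_i,\ T\in\mathcal{M}\}$. Running time counts value and independence oracle calls; amortized running time $t$ means the expected total running time on the stream is at most (number of operations)$\cdot t$. $\Delta=\max_{x\in V}f(x)\big/\min_{T\subseteq V,\,x\notin T_0}f(x\mid T)$, $T_0$ being the elements with zero marginal contribution with respect to $T$. Base algorithm with parameter $N$ (a power of $2$): $L=\log_2 N$; for each level $\ell=0,\dots,L$ sets $S_\ell,S'_\ell,A_\ell,B_\ell$, initially empty; elements put into some $S_\ell$ carry their current weight $w$, and each $S_\ell$ is kept sorted by weight so that each candidate swap is computed with $O(\log k)$ independence calls. Insertion$(e)$: add $e$ to all $B_\ell$; if some $\ell$ has $|B_\ell|\ge N/2^\ell$, call LevelConstruct$(\ell^\star)$ for the smallest such $\ell^\star$. Deletion$(e)$: remove $e$ from all $A_\ell,B_\ell$; if $e\in S_\ell$ for some $\ell$,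 call LevelConstruct$(\ell)$ for the smallest such $\ell$. LevelConstruct$(\ell)$: $A_\ell\gets A_{\ell-1}\cup B_{\ell-1}$, $B_\ell\gets\emptyset$, $S_\ell\gets S_{\ell-1}$, $S'_\ell\gets S'_{\ell-1}$ (for $\ell=0$: $A_{-1}\cup B_{-1}$ is the set of present elements, $S_{-1}=S'_{-1}=\emptyset$); repeat: for every $e\in A_\ell$ set $w(e)\gets f(e\mid S'_\ell)$, $s_e\in\arg\min\{w(y):y\in S_\ell,\ S_\ell-y+e\in\mathcal{M}\}$; $E_\ell=\{e\in A_\ell:S_\ell+e\in\mathcal{M}\}$, $F_\ell=\{e\in A_\ell\setminus E_\ell: w(e)>2w(s_e)\}$, $A_\ell\gets E_\ell\cup F_\ell$; if $|A_\ell|\ge N/2^\ell$, remove $e$ from $A_\ell$ uniformly at random, $S_\ell\gets S_\ell+e-s_e$ (no removal if $e\in E_\ell$), $S'_\ell\gets S'_\ell+e$; until $|A_\ell|<N/2^\ell$; then if $\ell<L$ call LevelConstruct$(\ell+1)$. The output after each operation is $S_L$. Doubling scheme: start with $N=1$; whenever the number of operations processed reaches $N$, restart the base algorithm with $N$ doubled. *)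

(* Defs.v *)
From HB Require Import structures.
From mathcomp Require Import all_boot all_order all_algebra.
From mathcomp Require Import reals constructive_ereal exp.

Set Implicit Arguments.
Unset Strict Implicit.
Unset Printing Implicit Defensive.

Import Order.TTheory GRing.Theory Num.Theory.
Local Open Scope ring_scope.

Section SetFunctions.
Variables (R : realType) (V : finType).
Implicit Types (f : {set V} -> R) (M : {set {set V}}).

Definition marginal f (X Y : {set V}) : R := f (X :|: Y) - f Y.

Definition nonnegative f := forall X, 0 <= f X.
Definition monotone f := forall X Y : {set V}, X \subset Y -> f X <= f Y.
Definition submodular f :=
  forall (X Y : {set V}) (e : V), X \subset Y -> e \notin Y ->
    marginal f [set e] Y <= marginal f [set e] X.
Definition normalized f := f set0 = 0.

Definition matroid M :=
  [/\ set0 \in M,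
      forall X Y : {set V}, X \subset Y -> Y \in M -> X \in M
    & forall X Y : {set V}, X \in M -> Y \in M -> (#|X| < #|Y|)%N ->
        exists2 e, e \in Y :\: X & e |: X \in M].

Definition matroid_rank M : nat := \max_(T in M) #|T|.

(* The default value 0 is harmless: f >= 0, and the empty set is feasible. *)
Definition OPT f M (X : {set V}) : R :=
  \big[Num.max/0]_(T : {set V} | (T \subset X) && (T \in M)) f T.

(* The minimum ranges over the pairs (T, x) such that x has a nonzero marginal
   contribution to T; it is +oo, and Delta is 0, when there is no such pair,
   i.e. when f vanishes everywhere. *)
Definition Delta f : \bar R :=
  ((\big[maxe/0]_(x : V) (f [set x])%:E) /
   (\big[mine/+oo]_(p : {set V} * V | marginal f [set p.2] p.1 != 0%R)
      (marginal f [set p.2] p.1)%:E))%E.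

End SetFunctions.

(* Logarithms in asymptotic bounds are base 2 and at least 1. *)
Definition lg (R : realType) (x : R) : R := Num.max 1 (ln x / ln 2).

Section Streams.
Variable V : finType.

Variant operation := Insert of V | Delete of V.

Definition apply_op (X : {set V}) (o : operation) : {set V} :=
  match o with Insert e => e |: X | Delete e => X :\ e end.

Definition present_after (ops : seq operation) : {set V} :=
  foldl apply_op set0 ops.

(* No element is inserted while it is present; an element may be inserted
   again after its deletion. *)
Definition valid_stream (ops : seq operation) :=
  forall ops1 e ops2, ops = ops1 ++ Insert e :: ops2 ->
    e \notin present_after ops1.

End Streams.

(* Randomized programs that access f and M only through oracle calls. *)
Section Programs.
Variables (R : realType) (V : finType).

Inductive prog (A : Type) : Type :=
| Ret of A
| Value of {set V} & (R -> prog A)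
| Indep of {set V} & (bool -> prog A)
| Uniform of {set V} & (V -> prog A).

Fixpoint bind (A B : Type) (p : prog A) (g : A -> prog B) : prog B :=
  match p with
  | Ret a => g a
  | Value X c => Value X (fun x => bind (c x) g)
  | Indep X c => Indep X (fun b => bind (c b) g)
  | Uniform X c => Uniform X (fun e => bind (c e) g)
  end.

Fixpoint foldM (A B : Type) (g : A -> B -> prog A) (a : A) (s : seq B) :
    prog A :=
  if s is b :: s' then bind (g a b) (fun a' => foldM g a' s') else Ret a.

Variables (f : {set V} -> R) (M : {set {set V}}).

Fixpoint surely (A : Type) (p : prog A) (P : A -> Prop) : Prop :=
  match p with
  | Ret a => P a
  | Value X c => surely (c (f X)) P
  | Indep X c => surely (c (X \in M)) P
  | Uniform X c => forall e, e \in X -> surely (c e) P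
  end.

(* Expected number of value and independence oracle calls. *)
Fixpoint expected_cost (A : Type) (p : prog A) : R :=
  match p with
  | Ret _ => 0
  | Value X c => 1 + expected_cost (c (f X))
  | Indep X c => 1 + expected_cost (c (X \in M))
  | Uniform X c => #|X|%:R^-1 * \sum_(e in X) expected_cost (c e)
  end.

End Programs.

Arguments Ret {R V A}.
Arguments Value {R V A}.
Arguments Indep {R V A}.
Arguments Uniform {R V A}.

Notation "'let!' x ':=' p 'in' q" := (bind p (fun x => q))
  (at level 200, x name, p at level 100, q at level 200).

Section Algorithm.
Variables (R : realType) (V : finType).

(* A routine listing each S_l by nonincreasing weight; ties are broken
   arbitrarily. *)
Definition sorts_by_weight (srt : (V -> R) -> {set V} -> seq V) :=
  forall w S, perm_eq (srt w S) (enum S) /\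
              sorted (fun x y => w y <= w x) (srt w S).

Variable srt : (V -> R) -> {set V} -> seq V.

Definition upd (T : eqType) (U : Type) (g : T -> U) (x : T) (u : U) : T -> U :=
  fun y => if y == x then u else g y.

Definition query_marginal (e : V) (X : {set V}) : prog R V R :=
  Value (e |: X) (fun x => Value X (fun y => Ret (x - y))).

(* Binary search for the least j in [lo, hi] such that e together with the
   first j elements of s is dependent, given that j = hi is such; hi - lo
   units of fuel suffice. *)
Fixpoint prefix_search (fuel : nat) (s : seq V) (e : V) (lo hi : nat) :
    prog R V nat :=
  if fuel is fuel'.+1 then
    if (lo < hi)%N then
      let mid := ((lo + hi) %/ 2)%N in
      Indep (e |: [set x in take mid s]) (fun b =>
        if b then prefix_search fuel' s e mid.+1 hi
        else prefix_search fuel' s e lo mid)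
    else Ret lo
  else Ret lo.

(* For e with S + e dependent, an element of minimum weight among the y in S
   with S - y + e independent: if j is the length of the shortest prefix of the
   sorted S that is dependent together with e, this is the j-th element.  The
   result is None when e is a loop (j = 0), in which case there is no such y. *)
Definition find_swap (w : V -> R) (S : {set V}) (e : V) :
    prog R V (option V) :=
  let s := srt w S in
  let! j := prefix_search (size s) s e 0 (size s) in
  Ret (if j is i.+1 then Some (nth e s i) else None).

(* The sets A_l, S_l, S'_l of the level under construction, and the weights. *)
Record level := Level {
  lA : {set V}; lS : {set V}; lS' : {set V}; lw : V -> R }.

Definition reweigh (A S' : {set V}) (w : V -> R) : prog R V (V -> R) :=
  foldM (fun w e => let! m := query_marginal e S' in Ret (upd w e m))
        w (enum A).

(* Computes E_l :|: F_l together with the element to be removed from S_l if e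
   is selected: None for e in E_l, Some s_e for e in F_l.  Loops belong to
   neither set. *)
Definition sift (A S : {set V}) (w : V -> R) :
    prog R V ({set V} * (V -> option V)) :=
  foldM (fun (r : {set V} * (V -> option V)) e =>
      Indep (e |: S) (fun b =>
        if b then Ret (e |: r.1, upd r.2 e None) else
        let! o := find_swap w S e in
        Ret (if o is Some y then
               if 2 * w y < w e then (e |: r.1, upd r.2 e (Some y)) else r
             else r)))
    (set0, fun=> None) (enum A).

(* The loop "repeat ... until |A_l| < t".  Every iteration but the last one
   removes an element from A_l, so that #|A_l|.+1 units of fuel suffice. *)
Fixpoint construct_loop (fuel t : nat) (c : level) : prog R V level :=
  if fuel is fuel'.+1 then
    let! w := reweigh (lA c) (lS' c) (lw c) in
    let! r := sift (lA c) (lS c) w in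
    if (t <= #|r.1|)%N then
      Uniform r.1 (fun e =>
        let S := if r.2 e is Some y then e |: (lS c :\ y) else e |: lS c in
        let c' := Level (r.1 :\ e) S (e |: lS' c) w in
        if (#|lA c'| < t)%N then Ret c' else construct_loop fuel' t c')
    else Ret (Level r.1 (lS c) (lS' c) w)
  else Ret c.

Record state := State {
  cur : {set V};
  wt : V -> R;
  Sl : nat -> {set V};
  Sl' : nat -> {set V};
  Al : nat -> {set V};
  Bl : nat -> {set V} }.

Definition init_state : state :=
  State set0 (fun=> 0) (fun=> set0) (fun=> set0) (fun=> set0) (fun=> set0).

(* In the sequel N = 2 ^ L, so that N / 2 ^ l = 2 ^ (L - l) for l <= L. *)

(* Constructs the levels l, l + 1, ..., l + m. *)
Fixpoint construct_levels (L m l : nat) (st : state) : prog R V state :=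
  let: (A0, S0, S0') :=
    if l is l'.+1 then (Al st l' :|: Bl st l', Sl st l', Sl' st l')
    else (cur st, set0, set0) in
  let! c := construct_loop #|A0|.+1 (2 ^ (L - l)) (Level A0 S0 S0' (wt st)) in
  let st' := State (cur st) (lw c) (upd (Sl st) l (lS c))
                   (upd (Sl' st) l (lS' c)) (upd (Al st) l (lA c))
                   (upd (Bl st) l set0) in
  if m is m'.+1 then construct_levels L m' l.+1 st' else Ret st'.

Definition level_construct (L l : nat) (st : state) : prog R V state :=
  construct_levels L (L - l) l st.

Definition construct_first (L : nat) (P : pred nat) (st : state) :
    prog R V state :=
  if [seq l <- iota 0 L.+1 | P l] is l :: _ then level_construct L l st
  else Ret st.

Definition insertion (L : nat) (e : V) (st : state) : prog R V state :=
  let st' := State (e |: cur st) (wt st) (Sl st) (Sl' st) (Al st)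
                   (fun l => e |: Bl st l) in
  construct_first L (fun l => (2 ^ (L - l) <= #|Bl st' l|)%N) st'.

Definition deletion (L : nat) (e : V) (st : state) : prog R V state :=
  let st' := State (cur st :\ e) (wt st) (Sl st) (Sl' st)
                   (fun l => Al st l :\ e) (fun l => Bl st l :\ e) in
  construct_first L (fun l => e \in Sl st' l) st'.

Definition base_step (L : nat) (st : state) (o : operation V) :
    prog R V state :=
  match o with
  | Insert e => insertion L e st
  | Delete e => deletion L e st
  end.

Definition base_run (L : nat) (ops : seq (operation V)) : prog R V state :=
  foldM (base_step L) init_state ops.

(* The operations processed so far, log_2 of the current N, the state of the
   base algorithm, and the outputs so far, one after each operation. *)
Record dstate := DState {
  hist : seq (operation V);
  dL : nat;
  base : state;
  outs : seq {set V} }.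

(* Restarting the base algorithm means running it with the new N, from its
   initial state and with fresh randomness, on all operations so far. *)
Definition dynamic_step (d : dstate) (o : operation V) : prog R V dstate :=
  let h := rcons (hist d) o in
  let! st := base_step (dL d) (base d) o in
  if size h == (2 ^ dL d)%N then
    let! st' := base_run (dL d).+1 h in
    Ret (DState h (dL d).+1 st' (rcons (outs d) (Sl st' (dL d).+1)))
  else Ret (DState h (dL d) st (rcons (outs d) (Sl st (dL d)))).

Definition dynamic_algorithm (ops : seq (operation V)) :
    prog R V (seq {set V}) :=
  let! d := foldM dynamic_step (DState [::] 0 init_state [::]) ops in
  Ret (outs d).

End Algorithm.

(* Main.v *)
(** Approximation.  Give an element of S_l the weight f(e | S'_l) it had when it
    was selected.  A swap at least doubles the weight of the element it replaces,
    so f(S'_l) <= 2 w(S_l), while w(S_l) <= f(S_l) by submodularity.  The span of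
    the elements of S_l of weight at least x only grows under swaps, for every x;
    hence an element o discarded when its marginal value was v stays in the span
    of the elements of weight at least v / 2.  Counting an optimal solution level
    set by level set gives OPT <= f(S'_L) + 2 w(S_L) <= 4 f(S_L).

    Cost.  Since weights double, at most K = O(k log Delta) elements are selected
    during a construction, and constructing level l costs O(t K log k) where
    t = 2 ^ (L - l).  A level reconstructed because of insertions is paid for by
    the t insertions that filled B_l.  For deletions, the potential of level l
    is t K log k times the largest urgency of an element of S_l :\: S_(l-1), where
    the urgency of s falls linearly from 1 to 0 as the next deletion of s moves
    from 0 to t / (4 K) operations into the (fixed) future of the stream.  An
    operation raises it by O(K^2 log k).  A deletion that hits level l releases
    t K log k, and the K new samples, each uniform among at least t elements with
    pairwise distinct deletion times, restore only about a quarter of it in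
    expectation. *)

Require Import Defs.
From mathcomp Require Import all_boot all_order all_algebra.
From mathcomp Require Import reals constructive_ereal exp.
From mathcomp Require Import zify ring lra.

Set Implicit Arguments.
Unset Strict Implicit.
Unset Printing Implicit Defensive.

Import Order.TTheory GRing.Theory Num.Theory.
Local Open Scope ring_scope.

(** * Amortized accounting for randomized oracle programs *)

Section Budgets.
Variables (R : realType) (V : finType) (f : {set V} -> R) (M : {set {set V}}).

(* Run with b credits, each oracle call consuming one, p ends in some a with r
   credits left such that Q a r; at a random choice the credits may be
   redistributed among the outcomes as long as their mean does not exceed b. *)
Fixpoint affords (A : Type) (p : prog R V A) (b : R) (Q : A -> R -> Prop) :
    Prop :=
  match p with
  | Ret a => Q a b
  | Value X c => affords (c (f X)) (b - 1) Q
  | Indep X c => affords (c (X \in M)) (b - 1) Q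
  | Uniform X c => exists2 beta : V -> R,
      #|X|%:R^-1 * \sum_(e in X) beta e <= b &
      forall e, e \in X -> affords (c e) (beta e) Q
  end.

Lemma affords_mono (A : Type) (p : prog R V A) b (Q Q' : A -> R -> Prop) :
  (forall a r, Q a r -> Q' a r) -> affords p b Q -> affords p b Q'.
Proof.
move=> QQ'; elim: p b => [a|X c IH|X c IH|X c IH] b /=; [exact: QQ'| exact: IH
  | exact: IH |].
by case=> beta le_b H; exists beta => // e eX; apply/IH/H.
Qed.

Lemma affords_bind (A B : Type) (p : prog R V A) (g : A -> prog R V B) b Q :
  affords p b (fun a r => affords (g a) r Q) -> affords (bind p g) b Q.
Proof.
elim: p b => [a|X c IH|X c IH|X c IH] b //=; [exact: IH|exact: IH|].
by case=> beta le_b H; exists beta => // e eX; apply/IH/H.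
Qed.

Lemma affords_foldM (A B : Type) (g : A -> B -> prog R V A)
    (I : seq B -> A -> R -> Prop) (s : seq B) a b :
  (forall done x rest a r, s = done ++ x :: rest -> I done a r ->
     affords (g a x) r (I (rcons done x))) ->
  I [::] a b -> affords (foldM g a s) b (I s).
Proof.
move=> step; rewrite -[in I s]/([::] ++ s).
have: forall d x rest a r, [::] ++ s = d ++ x :: rest -> I d a r ->
    affords (g a x) r (I (rcons d x)) by [].
move: [::] => done {}step; elim: s done a b step => [|x s IH] done a b step Ia
  /=.
  by rewrite cats0.
apply: affords_bind; apply: affords_mono (step done x s a b erefl Ia) => a' r.
by rewrite -cat_rcons; apply: IH => d y rest a2 r2; rewrite cat_rcons;
  apply: step.
Qed.

Lemma affords_surely (A : Type) (p : prog R V A) b Q :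
  affords p b Q -> surely f M p (fun a => exists r, Q a r).
Proof.
elim: p b => [a|X c IH|X c IH|X c IH] b /=; [by exists b|exact: IH|exact: IH|].
by case=> beta _ H e eX; apply/IH/H.
Qed.

Lemma surely_mono (A : Type) (p : prog R V A) (P Q : A -> Prop) :
  (forall a, P a -> Q a) -> surely f M p P -> surely f M p Q.
Proof.
move=> PQ; elim: p => [a|X c IH|X c IH|X c IH] /=; [exact: PQ|exact: IH
  |exact: IH|].
by move=> H e eX; apply/IH/H.
Qed.

(** Each call costs one credit, a random choice does not raise the mean credit, and no final credit
    is negative. *)
Lemma affords_expected_cost (A : Type) (p : prog R V A) b Q :
  (forall a r, Q a r -> 0 <= r) -> affords p b Q -> expected_cost f M p <= b.
Proof.
move=> Q0; elim: p b => [a|X c IH|X c IH|X c IH] b /=.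
- exact: Q0.
- by move/IH; rewrite lerBrDl.
- by move/IH; rewrite lerBrDl.
case=> beta le_b H; apply: le_trans le_b; apply: ler_wpM2l.
  by rewrite invr_ge0.
by apply: ler_sum => e eX; apply/IH/H.
Qed.

End Budgets.

(** * Exchange properties of matroids *)

Section Matroids.
Variables (V : finType) (M : {set {set V}}).
Hypothesis matM : matroid M.

Lemma indep0 : set0 \in M. Proof. by case: matM. Qed.

Lemma indepS (X Y : {set V}) : X \subset Y -> Y \in M -> X \in M.
Proof. by case: matM => _ H _; apply: H. Qed.

Lemma depS (X Y : {set V}) : X \subset Y -> X \notin M -> Y \notin M.
Proof. by move=> XY; apply/contra/indepS. Qed.

Lemma indep_augment (X Y : {set V}) : X \in M -> Y \in M ->
  (#|X| < #|Y|)%N -> exists2 e, e \in Y :\: X & e |: X \in M.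
Proof. by case: matM => _ _; apply. Qed.

Lemma indep_extend (X Y : {set V}) : X \in M -> Y \in M -> (#|X| <= #|Y|)%N ->
  exists Z : {set V}, [/\ X \subset Z, Z \subset X :|: Y, Z \in M
                        & #|Z| = #|Y|].
Proof.
move=> XM YM; move En: (#|Y| - #|X|)%N => n.
elim: n X XM En => [|n IH] X XM En leXY.
  by exists X; rewrite subsetUl; split=> //; lia.
have [|e /setDP[eY eX] eXM] := indep_augment XM YM; first lia.
have cX : #|e |: X| = #|X|.+1 by rewrite cardsU1 eX.
have [||Z [XZ ZXY ZM cZ]] := IH _ eXM; [lia|lia|].
exists Z; split=> //; first exact: subset_trans (subsetUr _ _) XZ.
apply: subset_trans ZXY _; rewrite !subUset sub1set inE eY orbT.
by rewrite subsetUl subsetUr.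
Qed.

(* Exchanging e for an element y of its circuit preserves the span. *)
Lemma swap_dep (X : {set V}) (e y o : V) : X \in M -> e |: X \notin M ->
  y \in X -> e |: X :\ y \in M -> o |: X \notin M -> o \notin e |: X :\ y ->
  o |: (e |: X :\ y) \notin M.
Proof.
move=> XM eX yX eyM oX oX'; apply/negP => oM.
have eNX : e \notin X by apply: contra eX => eX; rewrite (setUidPr _) ?sub1set.
(* The larger set has one element more than [X], so if independent it would augment [X] by [o] or by
   [e]. *)
have [|z /setDP[]] := indep_augment XM oM.
  rewrite cardsU1 oX' cardsU1 !inE (negbTE eNX) andbF (cardsD1 y X) yX; lia.
rewrite !inE => /or3P[/eqP->|/eqP->|/andP[_ ->]] // _ zM.
  by rewrite zM in oX.
by rewrite zM in eX.
Qed.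

(** Extend [e] and the independent prefix to an independent [Z] inside [e |: S] with [#|S|]
    elements. [Z] omits the element completing the dependent prefix, so by cardinality it omits
    nothing else. *)
Lemma prefix_swap (S : {set V}) (s : seq V) (e : V) (i : nat) :
  S \in M -> perm_eq s (enum S) -> e |: [set x in take i s] \in M ->
  e |: [set x in take i.+1 s] \notin M -> (i < size s)%N ->
  nth e s i \in S /\ e |: S :\ nth e s i \in M.
Proof.
move=> SM sS iM i1M lt_i; set y := nth e s i.
have memS x : (x \in s) = (x \in S) by rewrite (perm_mem sS) mem_enum.
have yS : y \in S by rewrite -memS mem_nth.
have tS j : [set x in take j s] \subset S.
  by apply/subsetP => x; rewrite inE => /mem_take; rewrite memS.
split=> //.
have eS : e |: S \notin M by apply: depS i1M; apply/setUS/tS.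
have eNS : e \notin S by apply: contra eS => eS; rewrite (setUidPr _) ?sub1set.
have [|Z [XZ ZXY ZM cZ]] := indep_extend iM SM.
  rewrite cardsU1 inE; have -> : e \notin take i s.
    by apply: contra eNS => /mem_take; rewrite memS.
  have us : uniq s by rewrite (perm_uniq sS) enum_uniq.
  rewrite cardsE (card_uniqP _) ?take_uniq // size_take lt_i.
  by rewrite cardE -(perm_size sS).
have ZeS : Z \subset e |: S.
  by apply: subset_trans ZXY _; rewrite subUset setUS // subsetUr.
have yZ : y \notin Z.
  apply: contra i1M => yZ; apply: indepS ZM.
  rewrite (take_nth e lt_i); apply/subsetP => x.
  rewrite !inE mem_rcons inE => /or3P[/eqP->|/eqP->//|xt].
    by apply: (subsetP XZ); rewrite !inE eqxx.
  by apply: (subsetP XZ); rewrite !inE xt orbT.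
suff -> : e |: S :\ y = Z by [].
apply/esym/eqP; rewrite eqEcard; apply/andP; split.
  apply/subsetP => x xZ; have := subsetP ZeS _ xZ; rewrite !inE.
  case: eqP => //= _ xS; rewrite xS andbT; apply: contraNneq yZ => <- //.
by rewrite cZ cardsU1 !inE (negbTE eNS) andbF (cardsD1 y S) yS.
Qed.

Lemma indep_card_le_rank (T : {set V}) : T \in M -> (#|T| <= matroid_rank M)%N.
Proof. by move=> TM; rewrite /matroid_rank (bigD1 T) //= leq_maxl. Qed.

End Matroids.

(** Induction, matching an element of largest [a] with some [s] of at least that value. Deleting the
    pair lowers both counts by one up to that value; above it the left-hand set is empty. *)
Lemma sum_le_of_superlevel (R : realType) (V : finType) (O S : {set V})
    (a b : V -> R) :
  (forall s, s \in S -> 0 <= b s) ->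
  (forall x, 0 < x -> (#|[set o in O | (x <= a o)%R]| <=
                       #|[set s in S | (x <= b s)%R]|)%N) ->
  \sum_(o in O) a o <= \sum_(s in S) b s.
Proof.
move En: #|O| => n; elim: n O S En => [|n IH] O S En b0 H.
  by rewrite (cards0_eq En) big_set0; apply: sumr_ge0.
have [o0 o0O] : exists o, o \in O by apply/set0Pn; rewrite -card_gt0 En.
case: (@arg_maxP _ R V o0 (mem O) a o0O) => o oinO omax.
have oO : o \in O by [].
have [ao|ao] := lerP (a o) 0.
  apply: (@le_trans _ _ 0); last exact: sumr_ge0.
  by apply: sumr_le0 => i iO; apply: le_trans ao; apply: omax.
have [s] : exists s, s \in [set s in S | a o <= b s].
  apply/set0Pn; rewrite -card_gt0; apply: leq_trans (H _ ao).
  by rewrite card_gt0; apply/set0Pn; exists o; rewrite inE oO lexx.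
rewrite inE => /andP[sS le_s].
rewrite (big_setD1 o) //= [leRHS](big_setD1 s) //=; apply: lerD => //.
apply: IH => [|s'|x x0].
- by move: En; rewrite (cardsD1 o) oO => -[].
- by rewrite !inE => /andP[_]; apply: b0.
have [xa|ax] := lerP x (a o); last first.
  rewrite (_ : [set o in _ | _] = set0) ?cards0 //.
  apply/setP => u; rewrite !inE; apply/negP => /andP[/andP[_ uO]].
  by rewrite leNgt (le_lt_trans _ ax) //; apply: omax.
have := H x x0; rewrite (cardsD1 o) (cardsD1 s [set _ in _ | _]) !inE oO sS xa.
rewrite (le_trans xa le_s) !add1n ltnS => le1.
have eqD (T : {set V}) (h : V -> R) u :
    [set v in T :\ u | x <= h v] = [set v in T | x <= h v] :\ u.
  by apply/setP => v; rewrite !inE andbA.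
by rewrite !eqD.
Qed.

(** * Monotone submodular functions *)

Section SetFunctionLemmas.
Variables (R : realType) (V : finType) (f : {set V} -> R).
Hypotheses (f_mono : monotone f) (f_sub : submodular f) (f_norm : normalized f).

Local Notation mg e X := (marginal f [set e] X).

Lemma marginal_ge0 e X : 0 <= mg e X.
Proof. by rewrite subr_ge0; apply/f_mono/subsetUr. Qed.

Lemma marginal_in (e : V) (X : {set V}) : e \in X -> mg e X = 0.
Proof. by move=> eX; rewrite /marginal (setUidPr _) ?subrr ?sub1set. Qed.

Lemma marginal_antimono (e : V) (X Y : {set V}) : X \subset Y ->
  mg e Y <= mg e X.
Proof.
move=> XY; have [eY|eY] := boolP (e \in Y); last exact: f_sub.
by rewrite (marginal_in eY) marginal_ge0.
Qed.

Lemma le_sum_marginal (X O : {set V}) :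
  f (O :|: X) <= f X + \sum_(o in O) mg o X.
Proof.
move En: #|O| => n; elim: n O En => [|n IH] O En.
  by rewrite (cards0_eq En) set0U big_set0 addr0.
have [o oO] : exists o, o \in O by apply/set0Pn; rewrite -card_gt0 En.
rewrite (big_setD1 o) //= -{1}(setD1K oO) -setUA.
have := IH (O :\ o); move: En; rewrite (cardsD1 o) oO add1n => -[->] /(_ erefl).
have := @marginal_antimono o X (O :\ o :|: X) (subsetUr _ _).
rewrite {1}/marginal; lra.
Qed.

End SetFunctionLemmas.

(** * Invariants of a solution and the approximation ratio *)

Section Solutions.
Variables (R : realType) (V : finType) (f : {set V} -> R) (M : {set {set V}}).
Implicit Types (S A U : {set V}) (w : V -> R).

Local Notation mg e X := (marginal f [set e] X).

Definition is_marginal (x : R) := exists e X, x = mg e X.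

(** [sound_le] speaks of all subsets of [S] because swaps delete elements of [S]. *)
Record sound S (S' : {set V}) w : Prop := Sound {
  sound_indep : S \in M;
  sound_sub : S \subset S';
  sound_weight : forall s, s \in S -> is_marginal (w s);
  sound_le : forall T : {set V}, T \subset S -> \sum_(s in T) w s <= f T;
  sound_ge : f S' <= 2 * \sum_(s in S) w s }.

(** Discarded elements stay spanned by solution elements of at least half their current marginal.
    Zero marginals are exempt, in particular members of an independent [S], for which the condition
    fails. *)
Definition covers U A S (S' : {set V}) w := forall o, o \in U -> o \notin A ->
  mg o S' != 0 -> o |: [set s in S | mg o S' <= 2 * w s] \notin M.

(** The last clause expresses the minimality of [w y]: the elements at least as heavy as [y] already
    span [e]. *)
Definition is_swap S w (e : V) (o : option V) :=
  if o is Some y then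
    [/\ y \in S, 2 * w y < w e, e |: S :\ y \in M
      & e |: [set s in S | w y <= w s] \notin M]
  else e |: S \in M.

Definition swap S (e : V) (o : option V) :=
  if o is Some y then e |: S :\ y else e |: S.

Lemma eq_sound S (S' : {set V}) w w' : {in S, w =1 w'} ->
  sound S S' w -> sound S S' w'.
Proof.
move=> ww' [SM SS' sw sle sge]; split=> // [s sS|T TS|].
- by rewrite -ww' //; apply: sw.
- rewrite (eq_bigr w) ?sle // => s sT.
  by rewrite ww' //; apply: (subsetP TS).
by rewrite (eq_bigr w) // => s sS; rewrite ww'.
Qed.

Lemma eq_covers U A S (S' : {set V}) w w' : {in S, w =1 w'} ->
  covers U A S S' w -> covers U A S S' w'.
Proof.
move=> ww' cov o oU oA mo; have := cov o oU oA mo;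
  congr (is_true (_ |: _ \notin M)).
by apply/setP => s; rewrite !inE; case: (boolP (s \in S)) => //= sS;
  rewrite ww'.
Qed.

Hypotheses (f_mono : monotone f) (f_sub : submodular f) (f_norm : normalized f).
Hypothesis matM : matroid M.

Lemma is_marginal_ge0 x : is_marginal x -> 0 <= x.
Proof. by case=> e [X ->]; apply: marginal_ge0. Qed.

Lemma sound0 w : sound set0 set0 w.
Proof.
split=> //; first exact: indep0.
- by move=> s; rewrite inE.
- by move=> T; rewrite subset0 => /eqP->; rewrite big_set0 f_norm.
by rewrite f_norm big_set0 mulr0.
Qed.

Lemma sound_approx U S (S' : {set V}) w :
  sound S S' w -> covers U set0 S S' w -> OPT f M U <= 4 * f S.
Proof.
move=> [SM SS' sw sle sge] cov.
have w0 s : s \in S -> 0 <= w s by move=> /sw/is_marginal_ge0.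
have wS := sle S (subxx _).
have wS0 : 0 <= \sum_(s in S) w s by apply: sumr_ge0.
apply/bigmax_leP; split; first by lra.
move=> T /andP[TU TM].
have: \sum_(o in T) mg o S' <= \sum_(s in S) 2 * w s.
  apply: sum_le_of_superlevel => [s sS|x x0]; first by rewrite mulr_ge0 ?w0.
  rewrite leqNgt; apply/negP => lt.
  have [||o] := indep_augment matM _ _ lt.
  - by apply: indepS matM _ _ _ SM; apply/subsetP => s; rewrite inE => /andP[].
  - by apply: indepS matM _ _ _ TM; apply/subsetP => s; rewrite inE => /andP[].
  rewrite !inE => /andP[_ /andP[oT xo]] oM.
  have oU : o \in U by apply: (subsetP TU).
  have /negP := cov o oU (negbT (in_set0 o)) (lt0r_neq0 (lt_le_trans x0 xo)).
  apply; apply: indepS matM _ _ _ oM; apply/setUS/subsetP => s.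
  by rewrite !inE => /andP[-> /(le_trans xo)->].
rewrite -mulr_sumr => le2.
have := le_sum_marginal f_mono f_sub S' T.
have := f_mono (subsetUl T S'); lra.
Qed.

Lemma swapE S e o : exists2 S0 : {set V}, S0 \subset S & swap S e o = e |: S0.
Proof.
by case: o => [y|] /=; [exists (S :\ y); rewrite ?subD1set|exists S].
Qed.

(** Selecting [e] raises [f S'] by [w e] and the total weight by at least [w e - w y > w e / 2],
    which keeps the factor 2. By submodularity [e] has marginal at least [w e] over every part of
    [S]. *)
Lemma sound_swap S (S' : {set V}) w e o : sound S S' w -> w e = mg e S' ->
  e \notin S -> is_swap S w e o -> sound (swap S e o) (e |: S') w.
Proof.
move=> [SM SS' sw sle sge] we eS sw_o.
have we0 : 0 <= w e by rewrite we marginal_ge0.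
have [S0 S0S ES] := swapE S e o.
have eS0 : e \notin S0 by apply: contra eS; apply: (subsetP S0S).
split.
- by case: o sw_o {ES} => [y []|].
- by rewrite ES setUS // (subset_trans S0S).
- rewrite ES => s /setU1P[->|/(subsetP S0S)]; last exact: sw.
  by exists e, S'.
- rewrite ES => T TS; have [eT|eT] := boolP (e \in T); last first.
    apply: sle; apply: subset_trans S0S; apply/subsetP => s sT.
    have /setU1P[es|//] := subsetP TS s sT.
    by rewrite -es sT in eT.
  rewrite (big_setD1 e) //=.
  have TS0 : T :\ e \subset S by apply: subset_trans S0S; rewrite subDset.
  have := marginal_antimono f_mono f_sub e (subset_trans TS0 SS').
  have := sle _ TS0; rewrite {2}/marginal setD1K // we; lra.
have -> : f (e |: S') = w e + f S' by rewrite we /marginal subrK.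
case: o sw_o {ES} => [y [yS lt_y _ _]|_] /=.
  rewrite big_setU1 /= ?inE ?(negbTE eS) ?andbF //.
  by move: sge; rewrite (big_setD1 y) //=; lra.
by rewrite big_setU1 //=; lra.
Qed.

Lemma covers_swap U A S (S' : {set V}) w e o : sound S S' w -> w e = mg e S' ->
  e \notin S -> is_swap S w e o -> covers U A S S' w ->
  covers U (A :\ e) (swap S e o) (e |: S') w.
Proof.
move=> [SM SS' sw _ _] we eS sw_o cov u uU uA mu.
have we0 : 0 <= w e by rewrite we marginal_ge0.
have ueS' : u \notin e |: S' by apply: contraNN mu => /marginal_in->.
have [ue uS'] : u != e /\ u \notin S'.
  by move: ueS'; rewrite !inE negb_or => /andP.
have le_mu : mg u (e |: S') <= mg u S'.
  by apply: (marginal_antimono f_mono f_sub); apply: subsetUr.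
have {}mu' : mg u S' != 0.
  by apply: lt0r_neq0; apply: lt_le_trans le_mu; rewrite lt0r mu marginal_ge0.
have {}cov : u |: [set s in S | mg u (e |: S') <= 2 * w s] \notin M.
  apply: (depS matM) (cov u uU _ mu'); last first.
    by apply: contra uA => uA; rewrite !inE ue.
  by apply/setUS/subsetP => s; rewrite !inE => /andP[-> /(le_trans le_mu)].
move: (mg u _) cov => x; set X := [set s in S | _] => cov.
case: o sw_o => [y [yS lt_y eyM eyN]|eM] /=; last first.
  apply: (depS matM) cov; apply/setUS/subsetP => s; rewrite !inE.
  by case/andP=> -> ->; rewrite orbT.
(* If [x > 2 * w y], then [y] is not in [X], which survives the swap. Otherwise [e] enters the level
   set and replaces [y] without changing the span. *)
have [xy|yx] := lerP x (2 * w y); last first.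
  apply: (depS matM) cov; apply/setUS/subsetP => s; rewrite !inE.
  case/andP=> -> xs; rewrite xs !andbT orbC; apply/orP; left.
  by apply: contraTneq xs => ->; rewrite -ltNge.
have XS : X \subset S by apply/subsetP => s; rewrite inE => /andP[].
have yX : y \in X by rewrite inE yS.
apply: (depS matM) (_ : u |: (e |: X :\ y) \notin M).
  apply/setUS/subsetP => s; rewrite !inE => /predU1P[->|].
    by rewrite eqxx /=; apply: le_trans xy _; lra.
  by case/and3P=> -> -> ->; rewrite orbT.
apply: swap_dep => //.
- exact: (indepS matM) XS SM.
- apply: (depS matM) eyN; apply/setUS/subsetP => s; rewrite !inE.
  by case/andP=> -> ys; apply: le_trans xy _; lra.
- by apply: (indepS matM) eyM; apply/setUS/setSD.
apply: contra ueS'; apply/subsetP/setUS; apply: subset_trans SS'.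
exact: subset_trans (subD1set _ _) XS.
Qed.

Lemma swap_rank (h : R -> R) S w e o :
  (forall s, s \in e |: S -> 1 <= h (w s)) ->
  (forall y, y \in S -> 2 * w y < w e -> h (w y) + 1 <= h (w e)) ->
  e \notin S -> is_swap S w e o ->
  \sum_(s in S) h (w s) + 1 <= \sum_(s in swap S e o) h (w s).
Proof.
move=> h1 hS eS; case: o => [y [yS lt_y _ _]|_] /=; last first.
  by rewrite big_setU1 //=; have := h1 e (setU11 _ _); lra.
rewrite big_setU1 /= ?inE ?(negbTE eS) ?andbF // (big_setD1 y) //=.
by have := hS y yS lt_y; lra.
Qed.

End Solutions.

(** * Correctness and cost of the oracle routines *)

Section Queries.
Variables (R : realType) (V : finType) (f : {set V} -> R) (M : {set {set V}}).
Variable srt : (V -> R) -> {set V} -> seq V.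
Hypotheses (matM : matroid M) (srtP : sorts_by_weight srt).

Local Notation mg e X := (marginal f [set e] X).
Local Notation affords := (affords f M).

Lemma affords_reweigh (A S' : {set V}) (w : V -> R) b :
  affords (reweigh A S' w) b (fun w' r =>
    [/\ forall e, e \in A -> w' e = mg e S',
        forall e, e \notin A -> w' e = w e & r = b - 2 * #|A|%:R]).
Proof.
pose I (s : seq V) (w' : V -> R) r :=
  [/\ forall e, e \in s -> w' e = mg e S',
      forall e, e \notin s -> w' e = w e & r = b - 2 * (size s)%:R].
apply: affords_mono (@affords_foldM _ _ f M _ _ _ I (enum A) w b _ _).
- move=> w' r [H1 H2 ->]; split=> [e eA|e eA|]; last by rewrite cardE.
    by apply: H1; rewrite mem_enum.
  by apply: H2; rewrite mem_enum.
- move=> done x rest w' r _ [H1 H2 ->] /=; rewrite /I size_rcons -natr1.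
  split=> [e|e|]; last lra.
    rewrite mem_rcons inE /upd; case: eqP => [->//|_ /= /H1//].
  by rewrite mem_rcons inE negb_or /upd => /andP[/negbTE-> /H2].
by split=> //=; rewrite mulr0 subr0.
Qed.

(** Each call halves an interval of length below [2 ^ m], so [m] calls suffice. *)
Lemma affords_prefix_search m fuel s e lo hi b :
  (hi - lo <= fuel)%N -> (lo <= hi)%N -> (hi - lo < 2 ^ m)%N ->
  e |: [set x in take hi s] \notin M ->
  (forall i, (i < lo)%N -> e |: [set x in take i s] \in M) ->
  affords (prefix_search R fuel s e lo hi) b (fun j r =>
    [/\ e |: [set x in take j s] \notin M,
        forall i, (i < j)%N -> e |: [set x in take i s] \in M,
        (j <= hi)%N & b - m%:R <= r]).
Proof.
elim: fuel m lo hi b => [|fuel IH] m lo hi b le_f le_lh lt_m hiN loM /=.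
  have E : lo = hi by lia.
  by split=> //; rewrite ?E // lerBlDr lerDl.
case: ltnP => [lt_lh|le_hl] /=; last first.
  have E : lo = hi by lia.
  by split=> //; rewrite ?E // lerBlDr lerDl.
case: m lt_m => [|m] lt_m; first by rewrite expn0 in lt_m; lia.
rewrite expnS in lt_m.
set mid := ((lo + hi) %/ 2)%N; have Emid : (lo <= mid < hi)%N by rewrite /mid;
  lia.
have lt1 : (hi - mid.+1 < 2 ^ m)%N by rewrite /mid; lia.
have lt2 : (mid - lo < 2 ^ m)%N by rewrite /mid; lia.
have Em : (m.+1%:R : R) = m%:R + 1 by rewrite natr1.
case: ifPn => [midM|midN].
  apply: affords_mono (IH m _ _ _ _ _ lt1 hiN _); try lia.
    by move=> j r [? ? ? ?]; split=> //; lra.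
  move=> i lt_i; apply: (indepS matM) midM; apply/setUS/subsetP => x.
  rewrite !inE => xi.
  have le_im : (i <= mid)%N by lia.
  by move: xi; rewrite -(take_takel s le_im) => /mem_take.
apply: affords_mono (IH m _ _ _ _ _ lt2 midN _) => //; try lia.
by move=> j r [? ? ? ?]; split=> //; [lia|lra].
Qed.

Lemma affords_find_swap m (w : V -> R) (S : {set V}) e b :
  S \in M -> e |: S \notin M -> (#|S| < 2 ^ m)%N ->
  affords (find_swap srt w S e) b (fun o r =>
    b - m%:R <= r /\
    if o is Some y then
      [/\ y \in S, e |: S :\ y \in M & e |: [set s in S | w y <= w s] \notin M]
    else [set e] \notin M).
Proof.
move=> SM eSN cS; rewrite /find_swap; have [pS sS] := srtP w S.
set s := srt w S in pS sS *.
have memS x : (x \in s) = (x \in S) by rewrite (perm_mem pS) mem_enum.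
have szS : size s = #|S| by rewrite (perm_size pS) cardE.
apply: affords_bind; apply: affords_mono
  (@affords_prefix_search m _ s e 0 (size s) b _ _ _ _ _); rewrite ?subn0 //.
- move=> [|i] r [iN iM ile ler] /=; split=> //.
    by move: iN; rewrite take0 (_ : [set x in [::]] = set0) ?setU0 //;
      apply/setP.
  have [yS eyM] := prefix_swap matM SM pS (iM i (ltnSn i)) iN ile.
  (* The weights are nonincreasing along [s], so the dependent prefix ending in [y] consists of
     elements at least as heavy as [y]. *)
  split=> //; apply: (depS matM) iN; apply/setUS/subsetP => x;
    rewrite !inE => xi.
  rewrite -memS (mem_take xi) /=.
  have lt_x : (index x (take i.+1 s) < i.+1)%N.
    by rewrite (leq_trans (_ : _ < size (take i.+1 s))%N) ?index_mem //
      size_take_min geq_minl.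
  have -> : x = nth e s (index x (take i.+1 s)).
    by rewrite -(nth_take e lt_x) nth_index.
  apply: (@sorted_leq_nth _ (fun x y => w y <= w x)) => //.
  - by move=> y x0 z /= yx zy; apply: le_trans zy yx.
  - by rewrite inE; apply: leq_trans lt_x ile.
- by rewrite szS.
rewrite take_size (_ : [set x in s] = S) //.
by apply/setP => x; rewrite inE memS.
Qed.

(** A rejected [e] is a loop or has a lightest exchange partner [y] with [w e <= 2 * w y]; the
    elements at least as heavy as [y] then span [e] and meet the halved threshold. An element costs
    one test and at most [m] search calls. *)
Lemma affords_sift m (A S : {set V}) (w : V -> R) b :
  S \in M -> (#|S| < 2 ^ m)%N ->
  affords (sift srt A S w) b (fun r q =>
    [/\ r.1 \subset A, forall e, e \in r.1 -> is_swap M S w e (r.2 e),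
        forall e, e \in A -> e \notin r.1 ->
          e |: [set s in S | w e <= 2 * w s] \notin M
      & b - #|A|%:R * (m%:R + 1) <= q]).
Proof.
move=> SM cS.
pose I (s : seq V) (r : {set V} * (V -> option V)) q :=
  [/\ forall e, e \in r.1 -> e \in s,
      forall e, e \in r.1 -> is_swap M S w e (r.2 e),
      forall e, e \in s -> e \notin r.1 ->
          e |: [set s in S | w e <= 2 * w s] \notin M
    & b - (size s)%:R * (m%:R + 1) <= q].
apply: affords_mono
  (@affords_foldM _ _ f M _ _ _ I (enum A) (set0, fun=> None) b _ _).
- move=> r q [H1 H2 H3]; rewrite -cardE => H4; split=> //.
    by apply/subsetP => e /H1; rewrite mem_enum.
  by move=> e eA; apply: H3; rewrite mem_enum.
- move=> done x rest r q E [H1 H2 H3 H4].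
  have xd : x \notin done.
    have := enum_uniq A; rewrite E cat_uniq /= => /and3P[_ /norP[xd _] _].
    by [].
  have szE : (size (rcons done x))%:R = (size done)%:R + 1 :> R.
    by rewrite size_rcons natr1.
  have m0 : 0 <= m%:R :> R by [].
  have add o q' : is_swap M S w x o -> b - (size (rcons done x))%:R * (m%:R +
    1) <= q' ->
      I (rcons done x) (x |: r.1, upd r.2 x o) q'.
    move=> so le_q; split=> // e; rewrite ?mem_rcons ?inE /upd.
    - by case/predU1P=> [->|/H1->]; rewrite ?eqxx ?orbT.
    - by move=> /=; case: eqP => [->//|_ /H2].
    by case: eqP => //= _; apply: H3.
  have skip q' : x |: [set s in S | w x <= 2 * w s] \notin M ->
      b - (size (rcons done x))%:R * (m%:R + 1) <= q' -> I (rcons done x) r q'.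
    move=> xN le_q; split=> // e; rewrite ?mem_rcons ?inE.
    - by move/H1->; rewrite orbT.
    by case/predU1P=> [->//|]; apply: H3.
  move=> /=; case: ifPn => [xM|xN] /=; first by apply: add => //; rewrite szE;
    lra.
  apply: affords_bind.
  apply: affords_mono (affords_find_swap w (q - 1) SM xN cS) => o q' [le_q].
  have {}le_q : b - (size (rcons done x))%:R * (m%:R + 1) <= q' by rewrite szE;
    lra.
  case: o => [y|] /= => [[yS eyM eyN]|xN1].
    case: ltP => le_w; first exact: add.
    apply: skip => //; apply: (depS matM) eyN; apply/setUS/subsetP => s.
    by rewrite !inE => /andP[-> ys]; lra.
  by apply: skip => //; apply: (depS matM) xN1; apply: subsetUl.
by split=> //= [e|e|]; rewrite ?inE // mul0r subr0.
Qed.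

End Queries.

(** * Urgency of future deletions *)

Section Urgency.
Variables (R : realType) (V : finType).
Implicit Types (fut : seq (operation V)) (X : {set V}) (rho : R).

Definition deletes (o : operation V) (s : V) :=
  if o is Delete e then e == s else false.

(* This is 1 - d * rho, truncated at 0, if the next deletion of s comes after d
   other operations. *)
Fixpoint urgency rho fut (s : V) : R :=
  if fut is o :: fut' then
    if deletes o s then 1 else Num.max 0 (urgency rho fut' s - rho)
  else 0.

Definition max_urgency rho fut X : R :=
  \big[Num.max/0]_(s in X) urgency rho fut s.

Lemma urgency_ge0 rho fut s : 0 <= urgency rho fut s.
Proof. by case: fut => //= o fut; case: ifP => // _; rewrite le_max lexx. Qed.

Lemma urgency_le1 rho fut s : 0 <= rho -> urgency rho fut s <= 1.
Proof.
move=> rho0; elim: fut => //= o fut IH; case: ifP => // _.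
by rewrite ge_max ler01; lra.
Qed.

Lemma urgency_behead rho o fut s : ~~ deletes o s ->
  urgency rho fut s <= urgency rho (o :: fut) s + rho.
Proof. by move=> /negbTE/= ->; rewrite -lerBlDr le_max lexx orbT. Qed.

(* Distinct elements are deleted at distinct times. *)
Lemma sum_urgency rho fut X : 0 < rho ->
  \sum_(e in X) urgency rho fut e <= 1 + rho^-1.
Proof.
move=> rho0.
(* The induction needs a variable truncation point [x]: one operation moves it to [rho + x], and the
   at most one element deleted now contributes [1 - x]. *)
have gen x : 0 <= x <= 1 ->
    \sum_(e in X) Num.max 0 (urgency rho fut e - x) <= 1 + (1 - x) / rho.
  elim: fut x => [|o fut IH] x /andP[x0 x1].
    rewrite big1 => [|e _]; last by apply/max_idPl; rewrite sub0r oppr_le0.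
    by rewrite addr_ge0 ?divr_ge0 ?subr_ge0 // ltW.
  apply: (@le_trans _ _ (\sum_(e in X) (if deletes o e then 1 - x else 0) +
                    \sum_(e in X) Num.max 0 (urgency rho fut e - (rho + x)))).
    rewrite -big_split /=; apply: ler_sum => e _; case: ifP => _.
      rewrite ge_max addr_ge0 ?subr_ge0 //= ?le_max ?lexx //.
      by rewrite lerDl le_max lexx.
    rewrite add0r ge_max le_max lexx /= lerBlDr ge_max; apply/andP; split.
      by rewrite addr_ge0 // le_max lexx.
    by rewrite -lerBlDr le_max opprD addrA lexx orbT.
  have le1 : \sum_(e in X) (if deletes o e then 1 - x else 0) <= 1 - x.
    case: o => d /=; first by rewrite big1 // subr_ge0.
    apply: (@le_trans _ _ (\sum_e (if d == e then 1 - x else 0))).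
      rewrite [leRHS](bigID (mem X)) /= lerDl; apply: sumr_ge0 => e _.
      by case: ifP => //; rewrite subr_ge0.
    by rewrite -big_mkcond /= (eq_bigl (pred1 d)) ?big_pred1_eq // => e;
      rewrite /= eq_sym.
  (* Beyond 1 the truncation kills all later terms. *)
  have [le_rx|lt_rx] := lerP (rho + x) 1; last first.
    rewrite [X in _ + X]big1 ?addr0 => [|e _]; last first.
      by apply/max_idPl; have := urgency_le1 fut e (ltW rho0); lra.
    apply: le_trans le1 _; rewrite -subr_ge0.
    have : 0 <= (1 - x) / rho by rewrite divr_ge0 ?subr_ge0 // ltW.
    lra.
  have := IH (rho + x); rewrite le_rx addr_ge0 ?(ltW rho0) // => /(_ isT).
  have -> : (1 - (rho + x)) / rho = (1 - x) / rho - 1 by field; rewrite gt_eqF.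
  lra.
have := gen 0; rewrite lexx ler01 subr0 mul1r => /(_ isT); congr (_ <= _).
by apply: eq_bigr => e _; rewrite subr0; apply/max_idPr/urgency_ge0.
Qed.

Lemma max_urgency_ge0 rho fut X : 0 <= max_urgency rho fut X.
Proof. exact: bigmax_ge_id. Qed.

Lemma max_urgency0 rho fut : max_urgency rho fut set0 = 0.
Proof. by rewrite /max_urgency big_set0. Qed.

Lemma max_urgency_hit rho e fut X : e \in X ->
  1 <= max_urgency rho (Delete e :: fut) X.
Proof.
move=> eX; apply: (@le_trans _ _ (urgency rho (Delete e :: fut) e)).
  by rewrite /= eqxx.
exact: le_bigmax_cond.
Qed.

Lemma max_urgency_behead rho o fut X : 0 <= rho ->
  (forall s, s \in X -> ~~ deletes o s) ->
  max_urgency rho fut X <= max_urgency rho (o :: fut) X + rho.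
Proof.
move=> rho0 Xo; apply/bigmax_leP; split=> [|s sX].
  by rewrite addr_ge0 ?max_urgency_ge0.
apply: le_trans (urgency_behead rho fut (Xo s sX)) _; rewrite lerD2r.
exact: (@le_bigmax_cond _ _ _ _ _ _ (urgency rho (o :: fut))).
Qed.

(** A sum is used in place of a maximum, since the mean of [urgency rho fut e] over a random [e] is
    bounded by [sum_urgency]. *)
Lemma max_urgencyU1 rho fut X (Y : {set V}) e : Y \subset e |: X ->
  max_urgency rho fut Y <= max_urgency rho fut X + urgency rho fut e.
Proof.
move=> /subsetP YX; apply/bigmax_leP; split=> [|s /YX/setU1P[->|sX]].
- by rewrite addr_ge0 ?max_urgency_ge0 ?urgency_ge0.
- by rewrite lerDr max_urgency_ge0.
apply: (@le_trans _ _ (max_urgency rho fut X)).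
  exact: (@le_bigmax_cond _ _ _ _ _ _ (urgency rho fut)).
by rewrite lerDl urgency_ge0.
Qed.

End Urgency.

Lemma filter_iota_first (P : pred nat) a n :
  if [seq l <- iota a n | P l] is l :: _ then
    [/\ P l, (a <= l < a + n)%N & forall j, (a <= j < l)%N -> ~~ P j]
  else forall j, (a <= j < a + n)%N -> ~~ P j.
Proof.
elim: n a => [|n IH] a /=; first by move=> j le_j; exfalso; lia.
case: ifPn => [Pa|PNa]; first by split=> // [|j]; lia.
have := IH a.+1; case: [seq _ <- _ | _] => [Pn j le_j|l s [Pl le_l Pn]].
  by have [->//|ja] := eqVneq j a; apply: Pn; lia.
split=> // [|j le_j]; first lia.
by have [->//|ja] := eqVneq j a; apply: Pn; lia.
Qed.

(** * Cost of constructing one level *)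

Section Construction.
Variables (R : realType) (V : finType) (f : {set V} -> R) (M : {set {set V}}).
Variable srt : (V -> R) -> {set V} -> seq V.
Hypotheses (f_mono : monotone f) (f_sub : submodular f) (f_norm : normalized f).
Hypotheses (matM : matroid M) (srtP : sorts_by_weight srt).
(* [h] counts how often a marginal value can have doubled, so that the sum of
   [h] over a solution rises at every selection and never exceeds [k * H]. *)
Variables (h : R -> R) (H : R) (k m : nat).
Hypotheses (h_ge1 : forall x, is_marginal f x -> 1 <= h x)
  (h_double : forall x y, is_marginal f x -> is_marginal f y ->
     2 * x < y -> h x + 1 <= h y)
  (h_le : forall x, is_marginal f x -> h x <= H)
  (H_ge1 : 1 <= H) (k_gt0 : (0 < k)%N)
  (M_card : forall T : {set V}, T \in M -> (#|T| <= k)%N)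
  (k_lt : (k < 2 ^ m)%N).

Local Notation mg e X := (marginal f [set e] X).
Local Notation affords := (affords f M).
Local Notation sound := (sound f M).
Local Notation covers := (covers f M).

Let K : R := k%:R * H.

Lemma sound_rank_le (S S' : {set V}) w : sound S S' w ->
  \sum_(s in S) h (w s) <= K.
Proof.
move=> [SM _ sw _ _]; apply: (@le_trans _ _ (\sum_(s in S) H)).
  by apply: ler_sum => s /sw; apply: h_le.
rewrite sumr_const -[H *+ _]mulr_natl; apply: ler_wpM2r;
  first exact: le_trans H_ge1.
by rewrite ler_nat M_card.
Qed.

(** [A0] and [w0] are the initial candidates and weights. Only weights in [A0] change, which
    protects the solutions of earlier levels. *)
Definition level_inv (U A0 : {set V}) (w0 : V -> R) (c : level R V) :=
  [/\ sound (lS c) (lS' c) (lw c), covers U (lA c) (lS c) (lS' c) (lw c),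
      [disjoint lA c & lS c], lA c \subset A0 & lS c \subset U] /\
  forall e, e \notin A0 -> lw c e = w0 e.

(** [Y] is credit set aside. A selection raises [psi] by at least 1, so at most [K - psi] are to
    come; the extra 1 pays for an iteration without selection. An iteration costs [m + 3] calls per
    candidate: two for the marginal, one test, [m] for the search. Each selection also funds the
    mean urgency of a uniform sample among at least [t] candidates. *)
Lemma affords_construct_loop (U A0 S0 : {set V}) w0 (t a : nat) rho fut al Y
    fuel c b :
  (0 < t)%N -> 0 < rho -> 0 <= al -> A0 \subset U ->
  level_inv U A0 w0 c -> (#|lA c| < fuel)%N -> (#|lA c| <= a)%N ->
  let psi := \sum_(s in lS c) h (lw c s) in
  Y + (K - psi + 1) * (a%:R * (m%:R + 3)) +
    al * (max_urgency rho fut (lS c :\: S0) +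
          (K - psi) * ((1 + rho^-1) / t%:R)) <= b ->
  affords (construct_loop srt fuel t c) b (fun c' r =>
    [/\ level_inv U A0 w0 c', (#|lA c'| < t)%N
      & Y + al * max_urgency rho fut (lS c' :\: S0) <= r]).
Proof.
move=> t0 rho0 al0 A0U.
elim: fuel c b => [|fuel IH] c b // [[snd cov dis AA0 SU] w0E] cA ca psi le_b.
set q := a%:R * (m%:R + 3) in le_b *; set u := (1 + rho^-1) / t%:R in le_b *.
have q0 : 0 <= q by rewrite mulr_ge0 // addr_ge0.
have u0 : 0 <= u by rewrite divr_ge0 // addr_ge0 // invr_ge0 ltW.
move=> /=; apply: affords_bind.
apply: affords_mono (affords_reweigh f M (lA c) (lS' c) (lw c) b).
move=> w r1 [wA wN Er1].
have wS : {in lS c, lw c =1 w}.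
  move=> s sS; rewrite wN //; apply/negP => sA.
  by move/pred0P: dis => /(_ s) /=; rewrite sA sS.
have {}snd := eq_sound wS snd; have {}cov := eq_covers wS cov.
have Epsi : psi = \sum_(s in lS c) h (w s).
  by apply: eq_bigr => s sS; rewrite wS.
have psiK : psi <= K by rewrite Epsi; apply: sound_rank_le snd.
have wE e : e \notin A0 -> w e = w0 e.
  move=> eA0; rewrite wN ?w0E //; apply: contra eA0; exact: (subsetP AA0).
apply: affords_bind.
have lt_S : (#|lS c| < 2 ^ m)%N by apply: leq_ltn_trans k_lt;
  apply/M_card/(sound_indep snd).
apply: affords_mono
  (affords_sift f matM srtP (lA c) w r1 (sound_indep snd) lt_S).
move=> [A o] r2 /= [AA Ao AN le_r2].
have {}le_b : Y + (K - psi) * q + al * (max_urgency rho fut (lS c :\: S0) +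
    (K - psi) * u) <= r2.
  apply: le_trans le_r2; rewrite Er1.
  have : #|lA c|%:R * (m%:R + 3) <= q by rewrite ler_wpM2r ?ler_nat // addr_ge0.
  move: le_b; rewrite mulrDl mul1r; lra.
have disA : [disjoint A & lS c] by apply: disjointWl AA dis.
have {}cov : covers U A (lS c) (lS' c) w.
  move=> e eU eA me; have [ecA|ecA] := boolP (e \in lA c); last exact: cov.
  by rewrite -wA //; apply: AN.
have Kq : 0 <= (K - psi) * q by rewrite mulr_ge0 ?subr_ge0.
case: ifP => [le_t|/negbT]; last first.
  rewrite -ltnNge => lt_t /=; split=> //.
    by split=> //; split=> //; apply: subset_trans AA AA0.
  have : 0 <= al * ((K - psi) * u) by apply/(mulr_ge0 al0)/mulr_ge0;
    rewrite ?subr_ge0.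
  by move: le_b; rewrite mulrDr /=; lra.
(* One share [al * u] leaves the reserve and is handed to the outcomes as [al * urgency rho fut e];
   it covers their mean because [fut] is fixed before the draw. *)
pose D := Y + (K - psi) * q +
  al * (max_urgency rho fut (lS c :\: S0) + (K - psi - 1) * u).
exists (fun e => D + al * urgency rho fut e).
  have cA0 : 0 < #|A|%:R :> R by rewrite ltr0n (leq_trans t0).
  rewrite big_split /= sumr_const -mulr_sumr mulrDr -[D *+ _]mulr_natl.
  rewrite mulKf ?gt_eqF // mulrCA.
  have le_u : #|A|%:R^-1 * \sum_(e in A) urgency rho fut e <= u.
    rewrite mulrC; apply: ler_pM; rewrite ?sum_urgency //.
    - by apply: sumr_ge0 => e _; apply: urgency_ge0.
    - by rewrite invr_ge0 ltW.
    by rewrite lef_pV2 ?ler_nat // posrE ltr0n.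
  by have := ler_wpM2l al0 le_u; move: le_b; rewrite /D; lra.
move=> e eA; have eS : e \notin lS c.
  by apply/negP => eS; move/pred0P: disA => /(_ e) /=; rewrite eA eS.
have we : w e = mg e (lS' c) by apply: wA; apply: (subsetP AA).
have swe := Ao e eA; set c' := Level _ _ _ _.
have Ec' : lS c' = swap (lS c) e (o e) by [].
have inv : level_inv U A0 w0 c'.
  split; last exact: wE.
  have eU : e \in U by apply/(subsetP A0U)/(subsetP AA0)/(subsetP AA).
  have [S1 S1S ES] := swapE (lS c) e (o e); split.
  - by rewrite Ec'; apply: sound_swap.
  - by rewrite Ec'; apply: covers_swap.
  - rewrite Ec' ES; apply/pred0P => x /=; rewrite !inE.
    apply/negP => /andP[/andP[/negbTE-> xA] /= /(subsetP S1S) xS].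
    by move/pred0P: disA => /(_ x) /=; rewrite xA xS.
  - by apply: subset_trans (subD1set _ _) _; apply: subset_trans AA AA0.
  by rewrite Ec' ES subUset sub1set eU (subset_trans S1S SU).
have [[snd' _ _ _ _] _] := inv.
have psi' := sound_rank_le snd'.
have le_psi : psi + 1 <= \sum_(s in lS c') h (w s).
  rewrite Epsi Ec'; apply: (@swap_rank _ _ M) => //.
    move=> s /setU1P[->|sS]; apply: h_ge1; last exact: (sound_weight snd).
    by exists e, (lS' c).
  move=> y yS; apply: h_double; first exact: (sound_weight snd).
  by exists e, (lS' c).
have le_mx : al * max_urgency rho fut (lS c' :\: S0) <=
    al * (max_urgency rho fut (lS c :\: S0) + urgency rho fut e).
  apply: ler_wpM2l => //; apply: max_urgencyU1.
  have [S1 S1S ES] := swapE (lS c) e (o e); rewrite Ec' ES.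
  apply/subsetP => x; rewrite !inE => /andP[->] /predU1P[->|/(subsetP S1S)->];
    by rewrite ?eqxx ?orbT.
case: ifP => [lt_t|_] /=.
  split=> //; have : 0 <= al * ((K - psi - 1) * u).
    by apply/(mulr_ge0 al0)/mulr_ge0 => //; move: psi' le_psi => /=; lra.
  by move: le_mx; rewrite /D !mulrDr; lra.
have cA' : (#|lA c'| < #|A|)%N by rewrite /= [in ltnRHS](cardsD1 e) eA.
have cAA := subset_leq_card AA.
have cA2 := leq_trans cA' cAA.
apply: IH => //; [exact: leq_trans cA2 _|exact: leq_trans (ltnW cA2) ca|].
set psi1 := \sum_(s in _) _ in le_psi psi' *.
have : (K - psi1 + 1) * q <= (K - psi) * q by apply: ler_wpM2r => //; lra.
have : al * ((K - psi1) * u) <= al * ((K - psi - 1) * u).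
  by apply: ler_wpM2l => //; apply: ler_wpM2r => //; lra.
by move: le_mx; rewrite -/q -/u /D !mulrDr; lra.
Qed.

(** * Potential of the levels and cost of one operation *)

Section Levels.
Variable L : nat.

Local Notation thr l := (2 ^ (L - l))%N.

(* The construction of level l costs at most [c0 * thr l]. *)
Let c0 : R := (K + 1) * (4 * (m%:R + 3)).
(** At this rate [K] selections add at most [K * (1 + (rho l)^-1) / thr l = K / thr l + 1 / 4] to
    the mean of the maximum urgency. *)
Let rho (l : nat) : R := 4 * K / (thr l)%:R.

(** Disjointness from all solutions up to level [l] ensures that reweighing these candidates at the
    next level alters no weight stored for those solutions. *)
Definition level_ok (st : state R V) (l : nat) :=
  [/\ sound (Sl st l) (Sl' st l) (wt st),
      covers (cur st) (Al st l :|: Bl st l) (Sl st l) (Sl' st l) (wt st),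
      Al st l :|: Bl st l \subset cur st, Sl st l \subset cur st
    & (#|Al st l| < thr l)%N] /\
  forall i, (i <= l)%N -> [disjoint Al st l :|: Bl st l & Sl st i].

Definition prev_S (st : state R V) (l : nat) :=
  if l is l'.+1 then Sl st l' else set0.

(** Elements inherited from the previous level are left out, as their deletion rebuilds an earlier
    level. Each buffered element holds [4 * c0]. *)
Definition level_potential (st : state R V) fut l : R :=
  4 * c0 * ((thr l)%:R * max_urgency (rho l) fut (Sl st l :\: prev_S st l) +
            #|Bl st l|%:R).

Lemma K_ge1 : 1 <= K.
Proof.
rewrite -[1]mulr1; apply: ler_pM => //.
by rewrite ler1n.
Qed.

Lemma c0_gt0 : 0 < c0.
Proof.
have := K_ge1; have m0 : 0 <= m%:R :> R by [].
by move=> K1; rewrite !mulr_gt0 //; lra.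
Qed.

Lemma thr_gt0 l : 0 < (thr l)%:R :> R.
Proof. by rewrite ltr0n expn_gt0. Qed.

Lemma rho_gt0 l : 0 < rho l.
Proof. by rewrite divr_gt0 ?thr_gt0 // mulr_gt0 //; have := K_ge1; lra. Qed.

Lemma level_potential_ge0 st fut l : 0 <= level_potential st fut l.
Proof.
apply: mulr_ge0; first by rewrite mulr_ge0 // ltW // c0_gt0.
by apply/addr_ge0 => //; apply: mulr_ge0 => //; apply: max_urgency_ge0.
Qed.

Lemma thrS l : (l < L)%N -> thr l = (2 * thr l.+1)%N.
Proof. by move=> lt_l; rewrite -expnS subnSK. Qed.

Lemma sum_thr l : (l <= L)%N ->
  \sum_(l <= j < L.+1) (thr j)%:R <= 2 * (thr l)%:R :> R.
Proof.
move=> le_l; move En: (L - l)%N => n.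
elim: n l le_l En => [|n IH] l le_l En.
  have -> : l = L by apply/eqP; rewrite eqn_leq le_l -subn_eq0 En.
  by rewrite big_nat1 subnn expn0; lra.
have lt_l : (l < L)%N by rewrite -subn_gt0 En.
rewrite big_ltn // -En (thrS lt_l) natrM.
by have := IH l.+1 lt_l; rewrite subnS En => /(_ erefl); lra.
Qed.

Lemma eq_level_ok st st' j (A0 : {set V}) : level_ok st j ->
  cur st' = cur st -> Sl st' j = Sl st j -> Sl' st' j = Sl' st j ->
  Al st' j = Al st j -> Bl st' j = Bl st j ->
  (forall i, (i <= j)%N -> Sl st' i = Sl st i) ->
  (forall e, e \notin A0 -> wt st' e = wt st e) -> [disjoint A0 & Sl st j] ->
  level_ok st' j.
Proof.
move=> [[snd cov AU SU cA] dis] Ec ES ES' EA EB ESi Ew disA.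
have ww : {in Sl st j, wt st =1 wt st'}.
  move=> s sS; rewrite Ew //; apply/negP => sA.
  by move/pred0P: disA => /(_ s) /=; rewrite sA sS.
split; last by move=> i le_i; rewrite EA EB ESi //; apply: dis.
rewrite Ec ES ES' EA EB; split=> //; [exact: eq_sound ww snd|exact: eq_covers
  ww cov].
Qed.

Definition prev_level (st : state R V) (l : nat) :=
  if l is l'.+1 then (Al st l' :|: Bl st l', Sl st l', Sl' st l')
  else (cur st, set0, set0).

Definition put_level (st : state R V) (l : nat) (c : level R V) :=
  State (cur st) (lw c) (upd (Sl st) l (lS c)) (upd (Sl' st) l (lS' c))
        (upd (Al st) l (lA c)) (upd (Bl st) l set0).

Lemma construct_levelsE d l st :
  construct_levels srt L d l st =
  let p := prev_level st l in
  bind (construct_loop srt #|p.1.1|.+1 (thr l) (Level p.1.1 p.1.2 p.2 (wt st)))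
    (fun c => if d is d'.+1 then construct_levels srt L d' l.+1 (put_level st l
      c)
              else Ret (put_level st l c)).
Proof. by case: d => [|d]; case: l. Qed.

(** The factor 4 arises as [Al] and [Bl] of the previous level each have fewer than [2 * thr l]
    elements. At level 0 all present elements are candidates, so nothing has to be covered yet. *)
Lemma prev_levelP l st : (l <= L)%N -> (#|cur st| <= 2 ^ L)%N ->
  (forall j, (j < l)%N -> level_ok st j /\ (#|Bl st j| < thr j)%N) ->
  let p := prev_level st l in
  [/\ level_inv (cur st) p.1.1 (wt st) (Level p.1.1 p.1.2 p.2 (wt st)),
      p.1.1 \subset cur st, (#|p.1.1| <= 4 * thr l)%N, p.1.2 = prev_S st l
    & forall i, (i < l)%N -> [disjoint p.1.1 & Sl st i]].
Proof.
case: l => [|l] lL cU ok /=.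
  split=> //; last by rewrite subn0 (leq_trans cU) // leq_pmull.
  split=> //; split=> //=; rewrite ?sub0set //; first exact: sound0.
    by move=> o ->.
  by rewrite disjoint_sym disjoints_subset sub0set.
have [[[snd cov AU SU cA] dis] cB] := ok l (ltnSn l).
split=> //; first by split=> //; split=> //; apply: dis.
rewrite (leq_trans (leq_card_setU _ _)) // (_ : 4 * thr l.+1 = thr l + thr l)%N.
  by rewrite leq_add // ltnW.
by rewrite (thrS lL) addnn -mul2n mulnA.
Qed.

(** The level starts from the previous solution, hence with urgency term 0. One [c0 * thr l] pays
    for the calls; the other, with [4 * c0 * K], for the new potential. *)
Lemma affords_construct_level fut l st Y b : (l <= L)%N ->
  (#|cur st| <= 2 ^ L)%N ->
  (forall j, (j < l)%N -> level_ok st j /\ (#|Bl st j| < thr j)%N) ->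
  Y + (2 * c0 * (thr l)%:R + 4 * c0 * K) <= b ->
  let p := prev_level st l in
  affords (construct_loop srt #|p.1.1|.+1 (thr l)
             (Level p.1.1 p.1.2 p.2 (wt st))) b (fun c r =>
    (forall j, (j <= l)%N -> level_ok (put_level st l c) j) /\
    Y + level_potential (put_level st l c) fut l <= r).
Proof.
move=> lL cU ok le_b p; have [inv AU cA ES dis] := prev_levelP lL cU ok.
set t := (thr l)%:R in le_b *; have t0 : 0 < t := thr_gt0 l.
have K1 := K_ge1; have c00 := c0_gt0; have m0 : 0 <= m%:R :> R by [].
pose al := 4 * c0 * t.
have al0 : 0 < al by rewrite /al; apply: mulr_gt0 => //; apply: mulr_gt0.
have Eprev c : prev_S (put_level st l c) l = p.1.2.
  by rewrite ES; case: (l) => //= l'; rewrite /upd ltn_eqF.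
apply: affords_mono (@affords_construct_loop _ _ p.1.2 _ (thr l) #|p.1.1|
  (rho l) fut al Y _ _ b _ (rho_gt0 l) (ltW al0) AU inv _ _ _) => //=;
  rewrite ?expn_gt0 //; last first.
- set psi := \sum_(s in _) _.
  have [[snd _ _ _ _] _] := inv.
  have psiK : psi <= K := sound_rank_le snd.
  have psi0 : 0 <= psi.
    apply: sumr_ge0 => s sS; apply: le_trans (h_ge1 _) => //.
    exact: (sound_weight snd).
  rewrite setDv max_urgency0 add0r.
  have -> : (1 + (rho l)^-1) / t = t^-1 + (4 * K)^-1.
    by rewrite /rho -/t; field; rewrite !gt_eqF //; lra.
  have le1 : (K - psi + 1) * (#|p.1.1|%:R * (m%:R + 3)) <= c0 * t.
    have -> : c0 * t = (K + 1) * (4 * t * (m%:R + 3)) by rewrite /c0; ring.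
    apply: ler_pM; [lra| |lra|]; first by rewrite mulr_ge0 // addr_ge0.
    apply: ler_wpM2r; first by rewrite addr_ge0.
    by rewrite -natrM ler_nat.
  have le2 : al * ((K - psi) * (t^-1 + (4 * K)^-1)) <= 4 * c0 * K + c0 * t.
    have -> : 4 * c0 * K + c0 * t = al * (K * (t^-1 + (4 * K)^-1)).
      by rewrite /al; field; rewrite !gt_eqF //; lra.
    apply: ler_wpM2l; first exact: ltW.
    apply: ler_wpM2r; last lra.
    by rewrite addr_ge0 // invr_ge0 ?(ltW t0) // mulr_ge0 //; lra.
  lra.
move=> c r [[[snd cov disc AA SU] wE] cAl le_r]; split; last first.
  move: le_r; rewrite /level_potential Eprev /= /upd eqxx cards0 addr0.
  by rewrite mulrA.
move=> j; rewrite leq_eqVlt => /predU1P[->|lt_j].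
  split=> [|i]; rewrite /= /upd ?eqxx setU0; first by split=> //;
    apply: subset_trans AA AU.
  rewrite leq_eqVlt => /predU1P[->|lt_i]; first by rewrite eqxx.
  by rewrite ltn_eqF //; apply: disjointWl AA _; apply: dis.
have [okj _] := ok j lt_j.
apply: (@eq_level_ok st _ j p.1.1) => //=; rewrite /upd ?(ltn_eqF lt_j) //.
  by move=> i le_i; rewrite ltn_eqF // (leq_ltn_trans le_i).
exact: dis.
Qed.

Lemma affords_construct_levels fut d l st Y b : (l + d = L)%N ->
  (#|cur st| <= 2 ^ L)%N ->
  (forall j, (j < l)%N -> level_ok st j /\ (#|Bl st j| < thr j)%N) ->
  Y + \sum_(l <= j < L.+1) (2 * c0 * (thr j)%:R + 4 * c0 * K) <= b ->
  affords (construct_levels srt L d l st) b (fun st' r =>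
    [/\ cur st' = cur st, forall j, (j <= L)%N -> level_ok st' j,
        forall j, (j < l)%N -> Sl st' j = Sl st j /\ Bl st' j = Bl st j,
        forall j, (l <= j <= L)%N -> Bl st' j = set0
      & Y + \sum_(l <= j < L.+1) level_potential st' fut j <= r]).
Proof.
elim: d l st Y b => [|d IH] l st Y b Ed cU ok le_b; rewrite construct_levelsE;
  apply: affords_bind.
  have {}Ed : l = L by rewrite -Ed addn0.
  subst l; apply: affords_mono 
    (@affords_construct_level fut L st Y b (leqnn L) cU ok _).
    move=> c r [ok1 le_r]; split=> //.
    - by move=> j lt_j; rewrite /= /upd ltn_eqF.
    - by move=> j; rewrite -eqn_leq => /eqP <-; rewrite /= /upd eqxx.
    by rewrite big_nat1.
  by move: le_b; rewrite big_nat1.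
have lt_l : (l < L)%N by rewrite -Ed -addSnnS leq_addr.
move: le_b; rewrite big_ltn; last by rewrite ltnS ltnW.
set rest := \sum_(l.+1 <= j < L.+1) _ => le_b.
apply: affords_mono
  (@affords_construct_level fut l st (Y + rest) _ (ltnW lt_l) cU ok _).
  move=> c r [ok1 le_r].
  apply: affords_mono (IH l.+1 (put_level st l c)
    (Y + level_potential (put_level st l c) fut l) r _ cU _ _); last 3 first.
  - by rewrite -Ed addSnnS.
  - move=> j; rewrite ltnS => le_j; split; first exact: ok1.
    rewrite /= /upd; case: eqP => [_|/eqP ne]; first by rewrite cards0 expn_gt0.
    by have [] := ok j _; rewrite // ltn_neqAle ne.
  - by rewrite -/rest; lra.
  move=> st' r' [Ec ok' eq' B' le_r']; split=> //.
  - move=> j lt_j; have [-> ->] := eq' j (ltnW lt_j).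
    by rewrite /= /upd ltn_eqF.
  - move=> j /andP[]; rewrite leq_eqVlt => /predU1P[<- _|lt_j le_j].
      by have [_ ->] := eq' l (ltnSn l); rewrite /= /upd eqxx.
    by apply: B'; rewrite lt_j.
  rewrite big_ltn; last by rewrite ltnS ltnW.
  (* Later constructions touch neither level [l] nor the solution before it. *)
  have -> : level_potential st' fut l = level_potential (put_level st l c) fut
    l.
    have [ES EB] := eq' l (ltnSn l); rewrite /level_potential ES EB.
    have -> // : prev_S st' l = prev_S (put_level st l c) l.
    by case: (l) eq' => //= l' eq'; have [|-> _] := eq' l' _.
  by rewrite addrA.
by rewrite -addrA [rest + _]addrC.
Qed.

Definition state_ok (st : state R V) := forall l, (l <= L)%N ->
  level_ok st l /\ (#|Bl st l| < thr l)%N.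

Definition potential (st : state R V) fut : R :=
  \sum_(0 <= l < L.+1) level_potential st fut l.

Lemma potential_ge0 st fut : 0 <= potential st fut.
Proof. by apply: sumr_ge0 => l _; apply: level_potential_ge0. Qed.

(** The factor 24 has room for a rise of [20 * (c0 * K)] at each level kept, [4 * (c0 * K)] at each
    level rebuilt, and one further [4 * (c0 * K)]. *)
Definition op_cost : R := L.+1%:R * (24 * (c0 * K)).

(** [old] is the potential before the operation. At the first triggered level [l] it releases
    [4 * c0 * thr l], up to [4 * (c0 * K)]; as thresholds halve, this covers [2 * c0 * thr j] summed
    over all [j >= l]. *)
Lemma affords_construct_first fut (P : pred nat) st Y (old : nat -> R) b :
  (#|cur st| <= 2 ^ L)%N ->
  (forall j, (j <= L)%N -> (forall i, (i <= j)%N -> ~~ P i) ->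
     [/\ level_ok st j, (#|Bl st j| < thr j)%N
       & level_potential st fut j <= old j + 20 * (c0 * K)]) ->
  (forall j, 0 <= old j) ->
  (forall l, (l <= L)%N -> P l -> (forall i, (i < l)%N -> ~~ P i) ->
     4 * c0 * (thr l)%:R <= old l + 4 * (c0 * K)) ->
  Y + \sum_(0 <= j < L.+1) old j + op_cost <= b ->
  affords (construct_first srt L P st) b (fun st' r =>
    [/\ state_ok st', cur st' = cur st & Y + potential st' fut <= r]).
Proof.
rewrite /op_cost => cU ok old0 oldP le_b.
have x0 : 0 <= c0 * K by rewrite mulr_ge0 ?(ltW c0_gt0) // (le_trans _ K_ge1).
rewrite /construct_first; have := filter_iota_first P 0 L.+1.
case: [seq _ <- _ | _] => [PN|l s [Pl /= le_l PN]].
  have {}PN j : (j <= L)%N -> ~~ P j by move=> le_j; apply: PN.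
  have okj j : (j <= L)%N -> [/\ level_ok st j, (#|Bl st j| < thr j)%N
       & level_potential st fut j <= old j + 20 * (c0 * K)].
    by move=> le_j; apply: ok => // i le_i; apply/PN/(leq_trans le_i).
  split=> // [l le_l|]; first by have [? ? _] := okj l le_l.
  have : potential st fut <= \sum_(0 <= j < L.+1) (old j + 20 * (c0 * K)).
    by apply: ler_sum_nat => j /andP[_ le_j]; have [_ _] := okj j le_j.
  rewrite big_split /= sumr_const_nat subn0 -[_ *+ L.+1]mulr_natl.
  have : 0 <= L.+1%:R * (c0 * K) by rewrite mulr_ge0.
  by lra.
rewrite add0n ltnS in le_l.
have okj j : (j < l)%N -> [/\ level_ok st j, (#|Bl st j| < thr j)%N
     & level_potential st fut j <= old j + 20 * (c0 * K)].
  move=> lt_j; apply: ok; first exact: leq_trans (ltnW lt_j) le_l.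
  by move=> i le_i; apply: PN; rewrite /= (leq_ltn_trans le_i).
rewrite /level_construct.
pose low := \sum_(0 <= j < l) level_potential st fut j.
apply: affords_mono (@affords_construct_levels fut _ l st (Y + low) b _ cU _ _).
- move=> st' r [Ec ok' eq' B' le_r]; split=> // [j le_j|].
    split; first exact: ok'.
    have [lt_j|ge_j] := ltnP j l.
      by have [_ ->] := eq' j lt_j; have [] := okj j lt_j.
    by rewrite B' ?ge_j // cards0 expn_gt0.
  rewrite /potential (big_cat_nat _ (n := l)) //=; last exact: leqW.
  rewrite (eq_big_nat _ _ (F2 := level_potential st fut)) ?addrA // => j lt_j.
  have [ES EB] := eq' j lt_j; rewrite /level_potential ES EB.
  have -> // : prev_S st' j = prev_S st j.
  by case: j lt_j {ES EB} => //= j lt_j; have [] := eq' j (ltnW lt_j).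
- by rewrite subnKC.
- by move=> j lt_j; have [] := okj j lt_j.
have le_low : low <= \sum_(0 <= j < l) old j + l%:R * (20 * (c0 * K)).
  apply: (@le_trans _ _ (\sum_(0 <= j < l) (old j + 20 * (c0 * K)))).
    by apply: ler_sum_nat => j /andP[_ lt_j]; have [] := okj j lt_j.
  by rewrite big_split /= sumr_const_nat subn0 -[_ *+ l]mulr_natl.
have le_old : \sum_(0 <= j < l) old j + old l <= \sum_(0 <= j < L.+1) old j.
  rewrite [leRHS](big_cat_nat _ (n := l)) //=; last exact: leqW.
  rewrite lerD2l big_ltn // lerDl; exact: sumr_ge0.
have := oldP l le_l Pl (fun i lt_i => PN i lt_i).
rewrite big_split /= -mulr_sumr sumr_const_nat -[_ *+ (_ - _)]mulr_natl.
have c20 : 0 <= 2 * c0 by rewrite mulr_ge0 // ltW // c0_gt0.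
have := ler_wpM2l c20 (sum_thr le_l).
have le_l1 : (l <= L.+1)%N := leqW le_l.
have xl : 0 <= l%:R * (c0 * K) by rewrite mulr_ge0.
have xL : l%:R * (c0 * K) + c0 * K <= L.+1%:R * (c0 * K).
  rewrite -{2}[c0 * K]mul1r -mulrDl; apply: ler_wpM2r => //.
  by rewrite natr1 ler_nat.
rewrite (natrB _ le_l1); move: le_b; lra.
Qed.

Lemma aging_cost l : (thr l)%:R * rho l = 4 * K.
Proof. by rewrite /rho mulrC divfK // gt_eqF // thr_gt0. Qed.

(** One operation raises urgencies by at most [rho l], and
    [4 * c0 * thr l * rho l = 16 * (c0 * K)]. *)
Lemma level_potential_behead st st' o fut l n :
  Sl st' = Sl st -> (forall s, s \in Sl st l -> ~~ deletes o s) ->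
  (#|Bl st' l| <= #|Bl st l| + n)%N ->
  level_potential st' fut l <=
  level_potential st (o :: fut) l + 16 * (c0 * K) + 4 * c0 * n%:R.
Proof.
move=> ES dels cB; rewrite /level_potential ES.
have -> : prev_S st' l = prev_S st l by case: (l) => //= j; rewrite ES.
set X := _ :\: _; have c40 : 0 <= 4 * c0 by rewrite mulr_ge0 // ltW // c0_gt0.
have {}cB : (#|Bl st' l|%:R : R) <= #|Bl st l|%:R + n%:R.
  by rewrite -natrD ler_nat.
have := @max_urgency_behead _ _ (rho l) o fut X (ltW (rho_gt0 l)).
have dX s : s \in X -> ~~ deletes o s by move=> /setDP[/dels].
move=> /(_ dX)/(ler_wpM2l (ltW (thr_gt0 l))); rewrite mulrDr aging_cost.
move=> le_u; have := ler_wpM2l c40 (lerD le_u cB).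
have -> : 4 * c0 * ((thr l)%:R * max_urgency (rho l) (o :: fut) X + 4 * K +
  (#|Bl st l|%:R + n%:R)) = 4 * c0 * ((thr l)%:R *
  max_urgency (rho l) (o :: fut) X + #|Bl st l|%:R) + 16 * (c0 * K) +
  4 * c0 * n%:R by ring.
by [].
Qed.

Lemma affords_base_step st o fut Y b : state_ok st ->
  (#|cur st| < 2 ^ L)%N -> (if o is Insert e then e \notin cur st else true) ->
  Y + potential st (o :: fut) + op_cost <= b ->
  affords (base_step srt L st o) b (fun st' r =>
    [/\ state_ok st', cur st' = apply_op (cur st) o & Y + potential st' fut <=
      r]).
Proof.
move=> ok cU vo le_b; have c00 := c0_gt0; have K1 := K_ge1.
have cK : c0 <= c0 * K by rewrite -{1}[c0]mulr1 ler_wpM2l // ltW.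
have x0 : 0 <= c0 * K := le_trans (ltW c00) cK.
case: o vo le_b => e eU le_b /=; rewrite /insertion /deletion;
  set st' := State _ _ _ _ _ _.
- have cB j : (#|e |: Bl st j| <= #|Bl st j| + 1)%N.
    by rewrite cardsU1 addnC leq_add2l; case: (_ \notin _).
  apply: (affords_construct_first (st := st') _ _ _ _ le_b).
  + by rewrite (leq_trans _ cU) // cardsU1 eU.
  + move=> j le_j PN.
    have [[[snd cov AU SU cA] dis] _] := ok j le_j.
    split; last 2 first.
    * by rewrite ltnNge; apply: PN.
    * have := @level_potential_behead st st' (Insert e) fut j 1 erefl (fun _ _
      => isT) (cB j).
      by lra.
    split=> [|i le_i]; last first.
      (* Solutions contain only present elements, so the newly inserted [e] lies in none of them. *)
      have [[[_ _ _ SiU _] _] _] := ok i (leq_trans le_i le_j).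
      apply/pred0P => x /=; rewrite !inE; apply/negP => /andP[xAB xS].
      have xe : x != e by apply: contraNneq eU => <-; apply: (subsetP SiU).
      move/pred0P: (dis i le_i) => /(_ x) /=; rewrite xS !inE andbT.
      by move: xAB; rewrite (negbTE xe) /= => ->.
    split=> //=.
    * move=> u /setU1P[->|uU]; first by rewrite !inE eqxx orbT.
      by move=> uAB; apply: cov => //; apply: contra uAB;
        rewrite !inE orbCA => ->; rewrite orbT.
    * by rewrite setUCA setUS.
    by rewrite (subset_trans SU) // subsetUr.
  + by move=> j; apply: level_potential_ge0.
  move=> l le_l Pl _.
  (* Before the insertion the buffer may be one element short; the missing [4 * c0] fits in the
     slack [4 * (c0 * K)]. *)
  have {Pl} : (thr l)%:R <= #|Bl st l|%:R + 1 :> R.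
    have := leq_trans Pl (cB l); by rewrite -(ler_nat R) natrD.
  have c40 : 0 <= 4 * c0 by lra.
  move=> /(ler_wpM2l c40); rewrite /level_potential.
  have : 0 <= 4 * c0 * ((thr l)%:R * max_urgency (rho l) (Insert e :: fut)
    (Sl st l :\: prev_S st l)) by rewrite mulr_ge0 // mulr_ge0 //
      max_urgency_ge0.
  by lra.
apply: (affords_construct_first (st := st') _ _ _ _ le_b).
- by rewrite (leq_trans (subset_leq_card (subD1set _ _))) // ltnW.
- move=> j le_j PN; have [[[snd cov AU SU cA] dis] cB] := ok j le_j.
  have cB' : (#|Bl st j :\ e| <= #|Bl st j|)%N by
    apply/subset_leq_card/subD1set.
  split; last 2 first.
  + exact: leq_ltn_trans cB.
  + have dels s : s \in Sl st j -> ~~ deletes (Delete e) s.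
      by move=> sS; apply: contraTneq sS => <-; apply: PN.
    have := @level_potential_behead st st' (Delete e) fut j 0 erefl dels.
    by rewrite addn0 mulr0 addr0 => /(_ cB'); lra.
  have subAB : Al st' j :|: Bl st' j \subset Al st j :|: Bl st j.
    by apply: setUSS; apply: subD1set.
  split=> [|i le_i]; last exact: disjointWl subAB (dis i le_i).
  split=> //=.
  + move=> u /setD1P[ue uU]; rewrite !inE ue /= => uAB; apply: cov => //.
    by rewrite inE.
  + by rewrite -setDUl setSD.
  + by rewrite subsetD1 SU PN.
  by apply: leq_ltn_trans cA; apply/subset_leq_card/subD1set.
- by move=> j; apply: level_potential_ge0.
move=> l le_l eS PN.
(* By minimality of [l] the element [e] is not inherited. Its urgency is 1 just before its deletion,
   which releases [4 * c0 * thr l]. *)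
have eX : e \in Sl st l :\: prev_S st l.
  by rewrite inE eS andbT; case: (l) PN => [|j] PN /=; rewrite ?inE //;
    apply: PN.
have := @max_urgency_hit _ _ (rho l) e fut _ eX.
have t0 := thr_gt0 l; have c40 : 0 <= 4 * c0 * (thr l)%:R.
  by rewrite mulr_ge0 ?(ltW t0) //; lra.
move=> /(ler_wpM2l c40); rewrite mulr1 /level_potential.
have : 0 <= 4 * c0 * #|Bl st l|%:R by rewrite mulr_ge0 //; lra.
by lra.
Qed.

Lemma affords_base_fold ops fut st Y b : state_ok st ->
  (#|cur st| + size ops <= 2 ^ L)%N ->
  (forall ops1 e ops2, ops = ops1 ++ Insert e :: ops2 ->
     e \notin foldl (@apply_op V) (cur st) ops1) ->
  Y + potential st (ops ++ fut) + (size ops)%:R * op_cost <= b ->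
  affords (foldM (base_step srt L) st ops) b (fun st' r =>
    [/\ state_ok st', cur st' = foldl (@apply_op V) (cur st) ops
      & Y + potential st' fut <= r]).
Proof.
elim: ops st b => [|o ops IH] st b ok cU val /=.
  by rewrite mul0r addr0.
rewrite -natr1 mulrDl mul1r => le_b; apply: affords_bind.
have lt_U : (#|cur st| < 2 ^ L)%N by apply: leq_trans cU;
  rewrite /= addnS ltnS leq_addr.
apply: affords_mono (@affords_base_step st o (ops ++ fut)
  (Y + (size ops)%:R * op_cost) b ok lt_U _ _); last by lra.
  move=> st' r [ok' Ec le_r]; rewrite -Ec; apply: IH => //; last by lra.
    rewrite Ec (leq_trans _ cU) //= addnS -addSn leq_add2r.
    case: (o) => e /=; last by rewrite ltnW // ltnS subset_leq_card // subD1set.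
    by rewrite cardsU1 -add1n leq_add2r leq_b1.
  by move=> ops1 e ops2 E; rewrite Ec; apply: (val (o :: ops1) e ops2);
    rewrite E.
by case: (o) val => // e val; apply: (val [::] e ops).
Qed.

Lemma state_ok_init : state_ok (init_state R V).
Proof.
move=> l _; split; last by rewrite cards0 expn_gt0.
split=> /= [|i _]; last by rewrite disjoints_subset setU0 sub0set.
split; rewrite ?setU0 ?sub0set ?cards0 ?expn_gt0 //; first exact: sound0.
by move=> o; rewrite inE.
Qed.

Lemma potential_init fut : potential (init_state R V) fut = 0.
Proof.
rewrite /potential big1_seq // => l _; rewrite /level_potential /=.
by rewrite set0D max_urgency0 cards0 mulr0 addr0 mulr0.
Qed.

(** The threshold of level [L] is 1, so [Al] and [Bl] are empty there and [covers] applies to all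
    present elements. *)
Lemma state_ok_output st : state_ok st ->
  [/\ Sl st L \subset cur st, Sl st L \in M & OPT f M (cur st) <= 4 * f (Sl st
    L)].
Proof.
move=> /(_ L (leqnn L))[[[snd cov _ SU cA] _]]; rewrite subnn expn0 in cA *.
rewrite ltnS leqn0 cards_eq0 => /eqP EB.
move: cA; rewrite ltnS leqn0 cards_eq0 => /eqP EA.
split=> //; first exact: (sound_indep snd).
by apply: sound_approx snd _ => //; move: cov; rewrite EA EB setU0.
Qed.

End Levels.

Lemma card_present_after (ops : seq (operation V)) :
  (#|present_after ops| <= size ops)%N.
Proof.
elim/last_ind: ops => [|ops o IH]; first by rewrite cards0.
rewrite /present_after foldl_rcons size_rcons -/(present_after ops).
case: o => e /=; last by rewrite (leq_trans (subset_leq_card (subD1set _ _)))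
  // leqW.
by rewrite cardsU1 -add1n leq_add // leq_b1.
Qed.

Let unit_cost : R := 24 * ((K + 1) * (4 * (m%:R + 3)) * K).

Lemma unit_cost_ge0 : 0 <= unit_cost.
Proof.
apply: mulr_ge0 => //; have := c0_gt0; have := K_ge1 => K1 c00.
by apply: mulr_ge0; [apply: ltW|apply: le_trans K1].
Qed.

(** * The doubling scheme *)

Section Doubling.
Variable ops : seq (operation V).
Hypothesis valid : valid_stream ops.

Let n := size ops.
Let logn := trunc_log 2 n.
(** [dL] never exceeds [logn.+1], so there are at most [logn.+2] levels. *)
Let step_cost : R := (logn.+2)%:R * unit_cost.

Definition output_ok i (S : {set V}) := let V_i := present_after (take i.+1
  ops) in
  [/\ S \subset V_i, S \in M & OPT f M V_i <= 4 * f S].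

(* Before the restart at size 2 ^ dL, the 2 ^ dL.-1 or more operations processed
   since the previous restart have each saved 2 * step_cost. *)
Definition dstate_ok (done : seq (operation V)) (d : dstate R V) (r : R) :=
  [/\ hist d = done, state_ok (dL d) (base d),
      cur (base d) = present_after done, (size done < 2 ^ dL d)%N
    & (dL d <= logn.+1)%N] /\
  [/\ size (outs d) = size done,
      forall i, (i < size done)%N -> output_ok i (nth set0 (outs d) i)
    & potential (dL d) (base d) (drop (size done) ops) +
      (n - size done)%:R * (3 * step_cost) +
      (2 * size done - 2 ^ dL d)%:R * step_cost <= r].

Lemma step_cost_ge0 : 0 <= step_cost.
Proof. by rewrite mulr_ge0 // unit_cost_ge0. Qed.

Lemma op_cost_le l : (l <= logn.+1)%N -> op_cost l <= step_cost.
Proof.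
move=> le_l; rewrite /op_cost /step_cost; apply: ler_wpM2r.
  exact: unit_cost_ge0.
by rewrite ler_nat.
Qed.

(** Of the [3 * step_cost] allotted to an operation, one part pays for the base step and two are
    saved for the next restart. *)
Lemma affords_dynamic_step done x rest d r : ops = done ++ x :: rest ->
  dstate_ok done d r ->
  affords (dynamic_step srt d x) r (dstate_ok (rcons done x)).
Proof.
move=> Eops [[Eh ok Ec lt_h le_L] [szo out le_r]].
have sc0 := step_cost_ge0.
have En : (n = size done + (size rest).+1)%N by rewrite /n Eops size_cat.
have Edrop : drop (size done) ops = x :: rest by rewrite Eops drop_size_cat.
have Edrop' : drop (size (rcons done x)) ops = rest.
  by rewrite Eops -cat_rcons drop_size_cat.
have Etake : take (size done).+1 ops = rcons done x.
  by rewrite Eops -cat_rcons take_size_cat // size_rcons.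
rewrite Edrop (_ : n - size done = (size rest).+1)%N in le_r; last first.
  by rewrite En addKn.
have Esub : (n - size (rcons done x) = size rest)%N.
  by rewrite En size_rcons -addSnnS addKn.
have lt_c : (#|cur (base d)| < 2 ^ dL d)%N.
  by rewrite Ec (leq_ltn_trans (card_present_after _)).
have vx : (if x is Insert e then e \notin cur (base d) else true) : bool.
  by case: (x) Eops => // e Eops; rewrite Ec; apply: valid Eops.
pose dep := (2 * size done - 2 ^ dL d)%N.
have out' S' st L : state_ok L st -> cur st = present_after (rcons done x) ->
    S' = rcons (outs d) (Sl st L) ->
    size S' = size (rcons done x) /\ forall i, (i < size (rcons done x))%N ->
      output_ok i (nth set0 S' i).
  move=> okst Est ->; rewrite !size_rcons szo; split=> // i.
  rewrite ltnS leq_eqVlt => /predU1P[->|lt_i]; last first.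
    by rewrite nth_rcons szo lt_i; apply: out.
  rewrite nth_rcons szo ltnn eqxx /output_ok Etake -Est.
  exact: state_ok_output.
rewrite /dynamic_step; apply: affords_bind.
pose Y := (size rest)%:R * (3 * step_cost) + 2 * step_cost + dep%:R * step_cost.
apply: affords_mono (@affords_base_step (dL d) (base d) x rest Y r ok lt_c vx
  _);
  last first.
  have := op_cost_le le_L; move: le_r; rewrite /Y -/dep -natr1 mulrDl mul1r;
    lra.
move=> st r1 [ok1 Ec1 le_r1].
have {}Ec1 : cur st = present_after (rcons done x).
  by rewrite Ec1 Ec /present_after foldl_rcons.
rewrite Eh; have pot0 := potential_ge0 (dL d) st rest.
case: ifP => [/eqP Esz|/negbT neq].
  have le_n : (2 ^ dL d <= n)%N by rewrite -Esz En size_rcons addnS ltnS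
    leq_addr.
  have n0 : (0 < n)%N by apply: leq_trans le_n; rewrite expn_gt0.
  (* A restart has seen [2 ^ dL d] operations, so the next [dL] still respects the bound
     [logn.+1]. *)
  have le_L' : (dL d <= logn)%N by apply: trunc_log_max.
  apply: affords_bind; rewrite /base_run.
  apply: affords_mono (@affords_base_fold (dL d).+1 (rcons done x) rest
    (init_state R V) ((size rest)%:R * (3 * step_cost)) r1
    (@state_ok_init _) _ _ _).
  - move=> st' r2 [ok2 Ec2 le_r2] /=.
    have [o1 o2] := out' _ st' _ ok2 Ec2 erefl.
    split; split=> //=; first by rewrite Esz ltn_exp2l.
    rewrite Edrop' Esub Esz -expnS subnn mul0r addr0; move: le_r2; lra.
  - by rewrite cards0 add0n Esz leq_exp2l.
  - move=> ops1 e ops2 E; apply: (valid (ops2 := ops2 ++ rest)).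
    by rewrite Eops -cat_rcons E -catA.
  rewrite potential_init addr0.
  have := op_cost_le (leq_ltn_trans le_L' (ltnSn _) : ((dL d).+1 <= logn.+1)%N).
  move=> le_o.
  have := ler_wpM2l (ler0n R (size (rcons done x))) le_o => le_o2.
  (* The savings pay for replaying the whole history, whose length is [2 ^ dL d]; truncated
     subtraction can only enlarge [dep]. *)
  have le_dep : (size (rcons done x))%:R * step_cost <= (dep%:R + 2) *
    step_cost.
    apply: ler_wpM2r => //; rewrite -natrD ler_nat /dep.
    by move: Esz; rewrite size_rcons; lia.
  by move: le_r1; rewrite /Y; lra.
have [o1 o2] := out' _ st _ ok1 Ec1 erefl.
split; split=> //=.
  by rewrite ltn_neqAle neq size_rcons.
rewrite Edrop' Esub.
have le_dep : (2 * size (rcons done x) - 2 ^ dL d)%:R * step_cost <=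
    (dep%:R + 2) * step_cost.
  apply: ler_wpM2r => //; rewrite -natrD ler_nat /dep size_rcons; lia.
by move: le_r1; rewrite /Y; lra.
Qed.

Lemma affords_dynamic_algorithm :
  affords (dynamic_algorithm srt ops) (n%:R * (3 * step_cost)) (fun outs r =>
    [/\ 0 <= r, size outs = n
      & forall i, (i < n)%N -> output_ok i (nth set0 outs i)]).
Proof.
apply: affords_bind.
apply: affords_mono (@affords_foldM _ _ f M _ _ _ dstate_ok ops _ _ _ _).
- move=> d r [[_ _ _ _ _] [szo out le_r]] /=; split=> //; apply: le_trans le_r.
  have sc0 := step_cost_ge0; apply/addr_ge0/mulr_ge0 => //.
  apply: addr_ge0; first exact: potential_ge0.
  by apply/mulr_ge0/mulr_ge0.
- by move=> done x rest d r E; apply: affords_dynamic_step E.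
split; split=> //=; first exact: state_ok_init.
(* Initially the saved amount [0 - 1] truncates to 0. *)
by rewrite potential_init add0r subn0 muln0 sub0n mul0r addr0.
Qed.

End Doubling.
End Construction.

(** * Logarithm estimates *)

Lemma lg_ge1 (R : realType) (x : R) : 1 <= lg x.
Proof. by rewrite /lg le_max lexx. Qed.

Lemma ln2_gt0 (R : realType) : 0 < ln 2 :> R.
Proof. by apply: ln_gt0; lra. Qed.

Lemma trunc_log_le_lg (R : realType) (n : nat) : (trunc_log 2 n)%:R <= lg n%:R
  :> R.
Proof.
case: n => [|n]; first by rewrite trunc_log0 (le_trans _ (lg_ge1 _)).
rewrite /lg le_max; apply/orP; right; rewrite ler_pdivlMr ?ln2_gt0 //.
rewrite mulr_natl -lnXn // ler_ln ?posrE ?exprn_gt0 // -natrX ler_nat.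
exact: trunc_logP.
Qed.

(** * Counting doublings of marginal values *)

Section DoublingRank.
Variables (R : realType) (V : finType) (f : {set V} -> R).
Hypotheses (f_ge0 : nonnegative f) (f_mono : monotone f) (f_sub : submodular f).
Hypothesis (f_norm : normalized f).

Local Notation mg e X := (marginal f [set e] X).

Lemma DeltaE (p : {set V} * V) (x : V) : mg p.2 p.1 != 0 ->
  (forall q : {set V} * V, mg q.2 q.1 != 0 -> mg p.2 p.1 <= mg q.2 q.1) ->
  (forall y, f [set y] <= f [set x]) ->
  Delta f = (f [set x] / mg p.2 p.1)%:E.
Proof.
move=> p0 pmin xmax; rewrite /Delta.
have -> : (\big[maxe/0]_(y : V) (f [set y])%:E = (f [set x])%:E)%E.
  apply: le_anti; rewrite bigmax_le ?lee_fin ?f_ge0 //=; last first.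
    by move=> y _; rewrite lee_fin.
  exact: (@le_bigmax _ _ _ _ (fun y => (f [set y])%:E)).
have -> : (\big[mine/+oo]_(q : {set V} * V | mg q.2 q.1 != 0%R)
      (mg q.2 q.1)%:E = (mg p.2 p.1)%:E)%E.
  apply: le_anti; apply/andP; split.
    exact: (@bigmin_le_cond _ _ _ _ _ _ (fun q : {set V} * V => (mg q.2
      q.1)%:E)).
  by apply: le_bigmin; rewrite ?leey // => q q0; rewrite lee_fin; apply: pmin.
by rewrite inver (negbTE p0) -EFinM.
Qed.

(** By submodularity nonzero marginals lie between the least one, [d], and the largest singleton
    value. Hence the binary logarithm of [y / d] is at most [lg] of [Delta], and it gains 1 per
    doubling. *)
Lemma doubling_rank : exists h : R -> R,
  [/\ forall x, is_marginal f x -> 1 <= h x,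
      forall x y, is_marginal f x -> is_marginal f y -> 2 * x < y ->
        h x + 1 <= h y
    & forall x, is_marginal f x -> h x <= 3 * lg (fine (Delta f))].
Proof.
have D1 := lg_ge1 (fine (Delta f)).
have [/existsP[p0 p0N]|/existsPn all0] :=
    boolP [exists p : {set V} * V, mg p.2 p.1 != 0]; last first.
  have m0 x : is_marginal f x -> x = 0.
    by case=> e [X ->]; apply/eqP; rewrite -[_ == 0]negbK; apply: (all0 (X, e)).
  exists (fun=> 1); split=> // [x y /m0-> /m0->|x _]; last by lra.
  by rewrite mulr0 ltxx.
pose F (q : {set V} * V) := mg q.2 q.1.
case: (@arg_minP _ R _ p0 (fun q => F q != 0) F p0N) => p pN pmin.
case: (@arg_maxP _ R V p0.2 predT (fun y => f [set y]) isT) => x _ xmax.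
rewrite (@DeltaE p x) //; last by move=> y; apply: xmax.
rewrite /=; set d := mg p.2 p.1 in pN *.
have d0 : 0 < d by rewrite lt0r pN marginal_ge0.
have ln2 := ln2_gt0 R.
have lb y : is_marginal f y -> y != 0 -> d <= y <= f [set x].
  case=> e [X ->] yN; rewrite (pmin (X, e) yN) /=.
  apply: le_trans (xmax e isT).
  have := marginal_antimono f_mono f_sub e (sub0set X).
  by rewrite {2}/marginal setU0 f_norm subr0.
(* The offset 2 makes the passage from 0 to a nonzero marginal gain 1 as well; since [lg] is at
   least 1, the total stays below [3 * lg]. *)
pose h y := if y == 0 then 1 else 2 + ln (y / d) / ln 2.
have h2 y : is_marginal f y -> y != 0 -> 2 <= h y.
  move=> my yN; rewrite /h (negbTE yN) lerDl; have /andP[dy _] := lb y my yN.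
  by rewrite divr_ge0 ?(ltW ln2) // ln_ge0 // ler_pdivlMr // mul1r.
exists h; split=> [y my|y z my mz lt_yz|y my].
- have [y0|yN] := eqVneq y 0; first by rewrite /h y0 eqxx.
  by have := h2 y my yN; lra.
- have y0 := is_marginal_ge0 f_mono my.
  have zN : z != 0 by rewrite gt_eqF // (le_lt_trans _ lt_yz) // mulr_ge0.
  have [yE|yN] := eqVneq y 0.
    by have := h2 z mz zN; rewrite {2}/h yE eqxx; lra.
  have {}y0 : 0 < y by rewrite lt0r yN.
  have z0 : 0 < z by rewrite lt0r zN (is_marginal_ge0 f_mono).
  rewrite /h (negbTE yN) (negbTE zN) -addrA lerD2l.
  rewrite -[X in _ + X](divff (lt0r_neq0 ln2)) -mulrDl ler_pM2r ?invr_gt0 //.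
  rewrite -lnM ?posrE ?divr_gt0 // ler_ln ?posrE ?mulr_gt0 ?divr_gt0 ?invr_gt0
    //.
  by rewrite mulrAC ler_pM2r ?invr_gt0 // mulrC ltW.
have [yE|yN] := eqVneq y 0; first by rewrite /h yE eqxx;
  have := lg_ge1 (f [set x] / d); lra.
rewrite /h (negbTE yN); have /andP[dy yx] := lb y my yN.
have : ln (y / d) / ln 2 <= lg (f [set x] / d).
  rewrite /lg le_max; apply/orP; right; rewrite ler_pM2r ?invr_gt0 //.
  rewrite ler_ln ?posrE ?divr_gt0 ?(lt_le_trans d0) //; last exact: le_trans yx.
  by rewrite ler_pM2r ?invr_gt0.
by have := lg_ge1 (f [set x] / d); lra.
Qed.

End DoublingRank.

(** * Combination of the approximation and cost bounds *)

Theorem theorem13 (R : realType) :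
  exists C : R,
  forall (V : finType) (f : {set V} -> R) (M : {set {set V}}) (k : nat)
         (srt : (V -> R) -> {set V} -> seq V) (ops : seq (operation V)),
  nonnegative f -> monotone f -> submodular f -> normalized f ->
  matroid M -> matroid_rank M = k ->
  (Delta f < +oo)%E ->
  sorts_by_weight srt ->
  valid_stream ops ->
  let n := size ops in
  surely f M (dynamic_algorithm srt ops) (fun outs =>
    size outs = n /\
    forall i, (i < n)%N ->
      let V_i := present_after (take i.+1 ops) in
      let S_i := nth set0 outs i in
      [/\ S_i \subset V_i, S_i \in M & OPT f M V_i <= 4 * f S_i]) /\
  ((0 < k)%N ->
   expected_cost f M (dynamic_algorithm srt ops) <=
   n%:R * (C * (k%:R ^+ 2 * lg (k%:R : R) * lg (fine (Delta f)) ^+ 2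
                * lg (n%:R : R) ^+ 2))).
Proof.
(* In order: 3 step costs per operation; at most [3 * lg n] levels; 24 from [op_cost];
   [K + 1 <= 2 * K]; 4 from the candidate count; [m + 3 <= 5 * lg k]; 9 from squaring
   [K = k * (3 * D)]. *)
exists (3 * (3 * (24 * (2 * (4 * (5 * 9)))))) => V f M k srt ops f_ge0 f_mono
  f_sub f_norm matM rkM _ srtP val n.
have [h [h1 h2 h3]] := doubling_rank f_ge0 f_mono f_sub f_norm.
have D1 := lg_ge1 (fine (Delta f)).
have H1 : 1 <= 3 * lg (fine (Delta f)) by lra.
(* A matroid of rank 0 is treated as one of rank at most 1. *)
pose k' := maxn k 1; have k'0 : (0 < k')%N by rewrite leq_max orbT.
have Mk' T : T \in M -> (#|T| <= k')%N.
  by move=> TM; rewrite leq_max -rkM indep_card_le_rank.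
have run := affords_dynamic_algorithm f_mono f_sub f_norm matM srtP h1 h2 h3 H1
  k'0 Mk' (trunc_log_ltn k' (ltnSn 1)) val.
split.
  by apply: surely_mono (affords_surely run) => outs [r [_ ? ?]]; split.
move=> k0; apply: le_trans (affords_expected_cost _ run) _.
  by move=> outs r [].
have Ek' : k' = k by apply/maxn_idPl.
rewrite Ek' -/n; apply: ler_wpM2l => //.
have le_n := trunc_log_le_lg R n; have le_k := trunc_log_le_lg R k.
have n1 := lg_ge1 (n%:R : R); have k1 := lg_ge1 (k%:R : R).
move: le_n le_k n1 k1 D1 {run}.
have -> : ((trunc_log 2 n).+2)%:R = (trunc_log 2 n)%:R + 2 :> R.
  by rewrite -addn2 natrD.
have -> : ((trunc_log 2 k).+1)%:R = (trunc_log 2 k)%:R + 1 :> R.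
  by rewrite natr1.
set tn := (trunc_log 2 n)%:R; set tk := (trunc_log 2 k)%:R.
set ln := lg n%:R; set lk := lg k%:R; set D := lg _ => le_n le_k n1 k1 D1.
have kR1 : 1 <= k%:R :> R by rewrite ler1n.
have tn0 : 0 <= tn by []; have tk0 : 0 <= tk by [].
set K := k%:R * (3 * D); have K1 : 1 <= K by rewrite -[1]mulr1 ler_pM //; lra.
have -> : 3 * (3 * (24 * (2 * (4 * (5 * 9))))) * (k%:R ^+ 2 * lk * D ^+ 2 * ln
  ^+ 2) =
    3 * ((3 * ln ^+ 2) * (24 * ((2 * K) * (4 * (5 * lk)) * K))).
  by rewrite /K; ring.
(* The number of levels contributes a single factor [ln], which is at most its square. *)
have ln2 : ln <= ln ^+ 2 by rewrite expr2 ler_peMr //; lra.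
apply: ler_wpM2l => //. apply: ler_pM.
- by lra.
- by rewrite !mulr_ge0 //; lra.
- by lra.
apply: ler_wpM2l => //; apply: ler_wpM2r; first by lra.
by apply: ler_pM; lra.
Qed.
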